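(* Let $\Omega\subset\mathbb C^n$ be a bounded pseudoconvex domain whose boundary $\partial\Omega$ is Hölder. Then $\Omega$ is hyperconvex.
   Context: A bounded domain $\Omega\subset\mathbb C^n$ is called hyperconvex if there exists a negative continuous plurisubharmonic function $\rho$ on $\Omega$ such that for every $c>0$ the set $\{z\in\Omega:\rho(z)<-c\}$ is relatively compact in $\Omega$. For a bounded domain $\Omega\subset\mathbb C^n$, the boundary $\partial\Omega$ is called Hölder if it can be written locally as the graph of a Hölder continuous function. Explicitly: for every $a\in\partial\Omega$ there is, after an affine change of the complex coordinates $z=(z',z_n)$, $z'=(z_1,\dots,z_{n-1})$, taking $a$ to the origin, a ball $B_r=\{z:|z|<r\}$ and a real-valued Hölder continuous function $g$ (of some order $\beta\in(0,1]$) on $B'_r=\{(z',\mathrm{Re}\,z_n)\in\mathbb C^{n-1}\times\mathbb R: |z'|^2+|\mathrm{Re}\,z_n|^2<r^2\}$ such that $\Omega\cap B_r=\{z\in B_r:\mathrm{Im}\,z_n<g(z',\mathrm{Re}\,z_n)\}$. *)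

(* Defs.v *)
From HB Require Import structures.
From mathcomp Require Import all_boot all_order all_algebra.
From mathcomp Require Import complex.
From mathcomp Require Import all_classical all_reals all_analysis.

Set Implicit Arguments.
Unset Strict Implicit.
Unset Printing Implicit Defensive.

Import Order.TTheory GRing.Theory Num.Theory numFieldNormedType.Exports.

Local Open Scope classical_set_scope.
Local Open Scope ring_scope.
Local Open Scope complex_scope.

(* R[i] receives its modulus topology from the regular module R[i]^o; C^n is
   then 'rV[R[i]]_n with its usual (product) topology. *)
HB.instance Definition _ (R : rcfType) := NormedModule.copy R[i] R[i]^o.

Section SeveralComplexVariables.
Variable R : realType.

Definition boundary (T : topologicalType) (A : set T) : set T :=
  closure A `\` interior A.

Definition rel_compact_in (T : topologicalType) (A Omega : set T) : Prop :=
  compact (closure A) /\ closure A `<=` Omega.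

Definition domain (T : topologicalType) (Omega : set T) : Prop :=
  [/\ open Omega, connected Omega & Omega !=set0].

Definition usc_on (T : topologicalType) (Omega : set T) (u : T -> \bar R) :
    Prop :=
  forall (z : T) (c : R), Omega z -> (u z < c%:E)%E ->
    \forall w \near z, Omega w -> (u w < c%:E)%E.

Definition expi (t : R) : R[i] := cos t +i* sin t.

(* The closed affine discs {a + x b : |x| <= 1} may be degenerate (b = 0), and
   u = -oo is allowed.  By upper semicontinuity u is bounded above on the circle, so
   the integral is meaningful in [-oo, +oo[. *)
Definition psh (n : nat) (Omega : set 'rV[R[i]]_n) (u : 'rV[R[i]]_n -> \bar R) :
    Prop :=
  [/\ forall z, Omega z -> (u z < +oo)%E,
      usc_on Omega u
    & forall a b : 'rV[R[i]]_n,
        (forall x : R[i], `|x| <= 1 -> Omega (a + x *: b)) ->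
        (u a <= ((2 * pi)^-1)%:E *
          \int[lebesgue_measure]_(t in `[0%R, (2 * pi)%R]) u (a + expi t *: b)%R)%E].

(* Hoermander's convention for pseudoconvexity: no boundary regularity is
   presupposed. *)
Definition pseudoconvex (n : nat) (Omega : set 'rV[R[i]]_n) : Prop :=
  exists phi : 'rV[R[i]]_n -> R,
    [/\ {within Omega, continuous phi},
        psh Omega (EFin \o phi)
      & forall c : R, rel_compact_in [set z | Omega z /\ phi z < c] Omega].

Definition hyperconvex (n : nat) (Omega : set 'rV[R[i]]_n) : Prop :=
  exists rho : 'rV[R[i]]_n -> R,
    [/\ forall z, Omega z -> rho z < 0,
        {within Omega, continuous rho},
        psh Omega (EFin \o rho)
      & forall c : R, 0 < c ->
          rel_compact_in [set z | Omega z /\ rho z < - c] Omega].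

Definition sqnorm (n : nat) (z : 'rV[R[i]]_n) : R :=
  \sum_(j < n) (complex.Re (z 0 j) ^+ 2 + complex.Im (z 0 j) ^+ 2).

(* Euclidean balls, as opposed to those of the sup norm on 'rV. *)
Definition eball (n : nat) (r : R) : set 'rV[R[i]]_n :=
  [set z | sqnorm z < r ^+ 2].

Definition graph_sqnorm (n : nat) (x : 'rV[R[i]]_n * R) : R :=
  sqnorm x.1 + x.2 ^+ 2.

Definition graph_ball (n : nat) (r : R) : set ('rV[R[i]]_n * R) :=
  [set x | graph_sqnorm x < r ^+ 2].

Definition holder_on (n : nat) (D : set ('rV[R[i]]_n * R)) (beta : R)
    (g : 'rV[R[i]]_n * R -> R) : Prop :=
  exists K : R, forall x y, D x -> D y ->
    `|g x - g y| <= K * Num.sqrt (graph_sqnorm (x - y)) `^ beta.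

(* For z = (z', z_n) in C^n (n = m + 1): the pair (z', Re z_n). *)
Definition graph_coord (m : nat) (z : 'rV[R[i]]_m.+1) : 'rV[R[i]]_m * R :=
  (col' ord_max z, complex.Re (z 0 ord_max)).

(* The affine coordinates centred at a are w = (z - a) A with A invertible. *)
Definition holder_boundary (m : nat) (Omega : set 'rV[R[i]]_m.+1) : Prop :=
  forall a, boundary Omega a ->
    exists (A : 'M[R[i]]_m.+1) (r beta : R) (g : 'rV[R[i]]_m * R -> R),
      [/\ A \in unitmx, 0 < r, 0 < beta <= 1,
          holder_on (@graph_ball m r) beta g
        & [set (z - a) *m A | z in Omega] `&` @eball m.+1 r =
          [set w | @eball m.+1 r w /\
                   complex.Im (w 0 ord_max) < g (graph_coord w)]].

End SeveralComplexVariables.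

(* Main.v *)
Require Import Defs.
From HB Require Import structures.
From mathcomp Require Import all_boot all_order all_algebra.
From mathcomp Require Import complex finmap.
From mathcomp Require Import all_classical all_reals all_analysis.
From mathcomp Require Import ring lra.

(** A bounded pseudoconvex domain with Hölder boundary is hyperconvex: why.

    Let d be the distance to the complement of Omega. By Oka's theorem
    ([oka_psh]) the function - ln d is plurisubharmonic. Near a boundary point
    Omega is the part of space below a Hölder graph, so moving z down by e along
    a fixed vector v keeps it in Omega, at distance at least c e^N from the
    complement for some N ([holder_chart]); on the other hand
    d(z - e v) <= d(z) + e |v|. So - ln d(z - e v) / (N ln (1/e)) is at most
    1 + o(1) everywhere, at least 1/N - o(1) where d(z) <= e, and o(1) on a
    given compact subset of Omega. Up to a small constant, one minus this
    function is a positive s, with - s plurisubharmonic, which is at least 1 on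
    the compact set and at most some gam < 1 near the boundary
    ([local_barriers]). For a Lipschitz boundary one has N = 1 and gam would be
    arbitrarily small; for a Hölder boundary each step only gains the fixed
    factor gam.

    The gain is iterated. For scales dl k that decrease fast enough to 0 and
    gam < kap < 1, the functions kap^k s_k, the k-th one being used only where
    d < dl k, can be glued by minima: the k-th function beats the next one where
    that one comes into play. The minimum tends to 0 at the boundary and its
    negative is plurisubharmonic. To pass from one chart to another, note that
    at each scale the functions of any two charts agree up to a bounded factor,
    because they all lie between fixed multiples of kap^k. Hence a geometric
    mean with weights q_i, the i-th one being smallest near the centre of its
    chart, decides in favour of the right chart if the power eta of the barriers
    is small. Geometric means of positive functions whose negatives are
    plurisubharmonic have the same property ([geometric_mean_vpsh]). The
    negative of the resulting minimum, cut off at - 1/2, is the desired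
    exhaustion function ([hyperconvex_exhaustion]).

    Plurisubharmonicity is used throughout in its viscosity form [vpsh]: no
    affine disc through z admits a strictly superharmonic quadratic that touches
    the function from above at z. This form is local and passes to maxima,
    gluings and geometric means by exhibiting supporting functions
    ([vpsh_support]), and it suffices for Oka's theorem. It follows from the
    sub-mean value property by averaging over four rotations of a disc
    ([psh_vpsh]). Conversely it implies the maximum principle against real parts
    of polynomials, which approximate any continuous function on the circle by
    Fejer's theorem, and so the sub-mean value property ([vpsh_psh]). *)

Set Implicit Arguments.
Unset Strict Implicit.
Unset Printing Implicit Defensive.

Import Order.TTheory GRing.Theory Num.Theory numFieldNormedType.Exports.

Local Open Scope classical_set_scope.
Local Open Scope ring_scope.
Local Open Scope complex_scope.

(** * Norms with real values *)

(** The norm of a normed module over R[i] is an element of R[i]; [nr] is the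
    same number as an element of R. *)
HB.lock Definition nr (R : realType) (W : normedModType R[i]) (x : W) : R :=
  complex.Re `|x|.

Section Norm.
Variables (R : realType) (V : normedModType R[i]).

Lemma nrE (x : V) : `|x| = (nr x)%:C.
Proof. by rewrite !unlock RRe_real // normr_real. Qed.

Lemma nr_ge0 (x : V) : 0 <= nr x.
Proof. by rewrite -lecR -nrE normr_ge0. Qed.

Lemma nrD (x y : V) : nr (x + y) <= nr x + nr y.
Proof. by have := ler_normD x y; rewrite !nrE -rmorphD lecR. Qed.

Lemma nrN (x : V) : nr (- x) = nr x.
Proof. by rewrite !unlock normrN. Qed.

Lemma nrB (x y : V) : nr (x - y) = nr (y - x).
Proof. by rewrite -nrN opprB. Qed.

Lemma nr0 : nr (0 : V) = 0.
Proof. by rewrite !unlock normr0. Qed.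

Lemma nrZ (a : R[i]) (x : V) : nr (a *: x) = nr (a : R[i]) * nr x.
Proof.
suff: (nr (a *: x))%:C = (nr a)%:C * (nr x)%:C by rewrite -rmorphM => /complexI.
by rewrite -nrE normrZ -nrE; congr (_ * _); rewrite [in RHS]unlock RRe_real // normr_real.
Qed.

Lemma nbhs_nrP (z : V) (A : set V) :
  nbhs z A <-> exists2 e : R, 0 < e & forall w, nr (w - z) < e -> A w.
Proof.
split.
  move=> /nbhs_ballP[e /= e0 he].
  have ee : e = (complex.Re e)%:C by rewrite RRe_real // realE ltW.
  exists (complex.Re e); first by rewrite -ltcR -ee.
  move=> w hw; apply: he; rewrite -ball_normE /= distrC nrE ee ltcR //.
move=> [e e0 he]; apply/nbhs_ballP; exists e%:C => /=; first by rewrite ltcR.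
by move=> w; rewrite -ball_normE /= distrC nrE ltcR => /he.
Qed.

Lemma cont_nrP (f : V -> R) (z : V) :
  {for z, continuous f} <-> forall e : R, 0 < e -> exists2 d : R, 0 < d &
    forall w, nr (w - z) < d -> `|f w - f z| < e.
Proof.
split.
  move=> hf e e0.
  have /nbhs_nrP[d d0 hd] : nbhs z [set w | `|f w - f z| < e].
    by move/cvgrPdist_lt : hf => /(_ e e0); apply: filterS => w /=; rewrite distrC.
  by exists d.
move=> h; apply/cvgrPdist_lt => e e0; have [d d0 hd] := h e e0.
by apply/nbhs_nrP; exists d => // w /hd; rewrite distrC.
Qed.

Lemma lip_cont (f : V -> R) : (forall z w, f w - f z <= nr (w - z)) -> continuous f.
Proof.
move=> h z; apply/cont_nrP => e e0; exists e => // w hw.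
rewrite (le_lt_trans _ hw) // ler_norml h andbT.
by rewrite lerNl opprB nrB h.
Qed.

Lemma cont_nr : continuous (@nr R V).
Proof.
by apply: lip_cont => z w; rewrite lerBlDr (le_trans _ (nrD _ _)) // subrK.
Qed.

Lemma open_nrP (A : set V) :
  open A <-> forall z, A z -> exists2 e : R, 0 < e & forall w, nr (w - z) < e -> A w.
Proof.
rewrite openE; split => h z /h; first by move=> /nbhs_nrP.
by move=> ?; apply/nbhs_nrP.
Qed.

Lemma closure_nrP (A : set V) (z : V) :
  closure A z <-> forall e : R, 0 < e -> exists2 w, A w & nr (w - z) < e.
Proof.
split.
  move=> h e e0; have := h [set w | nr (w - z) < e].
  case; first by apply/nbhs_nrP; exists e.
  by move=> w [? ?]; exists w.
move=> h B /nbhs_nrP[e e0 he]; have [w Aw hw] := h e e0.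
by exists w; split => //; apply: he.
Qed.

Lemma contD_at (f g : V -> R) z : {for z, continuous f} -> {for z, continuous g} ->
  {for z, continuous (fun w => f w + g w)}.
Proof. by move=> cf cg; apply: cvgD. Qed.

Lemma contB_at (f g : V -> R) z : {for z, continuous f} -> {for z, continuous g} ->
  {for z, continuous (fun w => f w - g w)}.
Proof. by move=> cf cg; apply: cvgB. Qed.

Lemma contM_at (f g : V -> R) z : {for z, continuous f} -> {for z, continuous g} ->
  {for z, continuous (fun w => f w * g w)}.
Proof. by move=> cf cg; apply: cvgM. Qed.

Lemma cont_comp_at (f : V -> R) (g : R -> R) z : {for z, continuous f} ->
  {for f z, continuous g} -> {for z, continuous (fun w => g (f w))}.
Proof. by move=> cf cg; apply: (@continuous_comp _ _ _ f g). Qed.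

End Norm.

Lemma contV_nrP (R : realType) (V W : normedModType R[i]) (f : V -> W) (z : V) :
  {for z, continuous f} <-> forall e : R, 0 < e -> exists2 d : R, 0 < d &
    forall w, nr (w - z) < d -> nr (f w - f z) < e.
Proof.
split.
  move=> hf e e0.
  have /hf /nbhs_nrP[d d0 hd] : nbhs (f z) [set w | nr (w - f z) < e].
    by apply/nbhs_nrP; exists e.
  by exists d.
move=> h A /nbhs_nrP[e e0 he]; have [d d0 hd] := h e e0.
by apply/nbhs_nrP; exists d => // w /hd; apply: he.
Qed.

(** * The modulus of complex numbers *)

Section Cmod.
Variable R : realType.
Local Notation C := R[i].
Implicit Types x y : C.

Lemma nrC_sqr x : nr x ^+ 2 = complex.Re x ^+ 2 + complex.Im x ^+ 2.
Proof. by rewrite !unlock normc_def /= sqr_sqrtr // addr_ge0 // sqr_ge0. Qed.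

Lemma nrC_norm x : (nr x)%:C = `|x|.
Proof. by rewrite !unlock RRe_real // normr_real. Qed.

Lemma nrCM x y : nr (x * y) = nr x * nr y.
Proof. by have := normrM x y; rewrite -!nrC_norm -rmorphM => /complexI. Qed.

Lemma nrCX x n : nr (x ^+ n) = nr x ^+ n.
Proof. by have := normrX n x; rewrite -!nrC_norm -rmorphXn => /complexI. Qed.

Lemma nrC_Re x : `|complex.Re x| <= nr x.
Proof. by rewrite -lecR nrC_norm; exact: normc_ge_Re. Qed.

Lemma nrC_Im x : `|complex.Im x| <= nr x.
Proof.
rewrite -(@ler_pXn2r _ 2) ?nnegrE ?nr_ge0 // nrC_sqr real_normK ?num_real //.
by rewrite lerDr sqr_ge0.
Qed.

Lemma nrC_leD x : nr x <= `|complex.Re x| + `|complex.Im x|.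
Proof.
rewrite -(@ler_pXn2r _ 2) ?nnegrE ?nr_ge0 ?addr_ge0 // nrC_sqr.
rewrite sqrrD !real_normK ?num_real // lerD2r lerDl.
by rewrite mulrn_wge0 // mulr_ge0.
Qed.

Lemma nr_real (a : R) : nr (a%:C : C) = `|a|.
Proof. by rewrite !unlock normc_def /= expr0n /= addr0 sqrtr_sqr. Qed.

Lemma nrC1 : nr (1 : C) = 1.
Proof. by rewrite !unlock normr1. Qed.

Lemma nrC_i : nr ('i : C) = 1.
Proof. by rewrite unlock normc_def /= expr0n expr1n add0r sqrtr1. Qed.

Lemma nrC_le1 x : (`|x| <= 1) = (nr x <= 1).
Proof. by rewrite -nrC_norm -(@lecR R). Qed.

Lemma nrC_conj x : nr (x^*)%C = nr x.
Proof. by rewrite !unlock normcJ. Qed.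

Lemma nr_expi (t : R) : nr (expi t) = 1.
Proof. by rewrite !unlock normc_def /= cos2Dsin2 sqrtr1. Qed.

Lemma cont_Re : continuous (@complex.Re R).
Proof.
move=> x; apply/cont_nrP => e e0; exists e => // w hw.
have -> : complex.Re w - complex.Re x = complex.Re (w - x) by case: w {hw}; case: (x).
exact: le_lt_trans (nrC_Re _) hw.
Qed.

Lemma ReD x y : complex.Re (x + y) = complex.Re x + complex.Re y.
Proof. by case: x; case: y. Qed.
Lemma ImD x y : complex.Im (x + y) = complex.Im x + complex.Im y.
Proof. by case: x; case: y. Qed.
Lemma ReN x : complex.Re (- x) = - complex.Re x.
Proof. by case: x. Qed.
Lemma ImN x : complex.Im (- x) = - complex.Im x.
Proof. by case: x. Qed.
Lemma ReM x y : complex.Re (x * y) = complex.Re x * complex.Re y - complex.Im x * complex.Im y.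
Proof. by case: x; case: y. Qed.
Lemma ImM x y : complex.Im (x * y) = complex.Re x * complex.Im y + complex.Im x * complex.Re y.
Proof. by case: x; case: y. Qed.
Lemma ReZ (a : R) x : complex.Re (a%:C * x) = a * complex.Re x.
Proof. by rewrite ReM /= mul0r subr0. Qed.
Lemma Re_sum (I : Type) (r : seq I) (P : pred I) (F : I -> C) :
  complex.Re (\sum_(i <- r | P i) F i) = \sum_(i <- r | P i) complex.Re (F i).
Proof. by apply: (big_morph _ ReD). Qed.

Lemma nrC_sqrD x y :
  nr (x + y) ^+ 2 = nr x ^+ 2 + 2 * complex.Re (x^*%C * y) + nr y ^+ 2.
Proof.
by rewrite !nrC_sqr ReD ImD ReM; case: x => a1 a2; case: y => b1 b2 /=; ring.
Qed.

(** The disc is closed in the image of a compact square of R * R under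
    (x, y) |-> c + x + i y. *)
Lemma cdisc_compact (c : C) (r : R) : compact [set x : C | nr (x - c) <= r].
Proof.
pose f (p : R * R) : C := c + (p.1 +i* p.2).
have cf : continuous f.
  move=> p A /nbhs_nrP[e e0 he].
  have e20 : 0 < e / 2 by rewrite divr_gt0.
  have [q h1 h2] : nbhs p [set q | `|q.1 - p.1| < e / 2 /\ `|q.2 - p.2| < e / 2].
    exists (ball p.1 (e / 2), ball p.2 (e / 2)) => /=.
      by split; apply: nbhsx_ballx.
    by move=> [a b] [] /=; rewrite -!ball_normE /= ![ `|_ - a| ]distrC ![ `|_ - b| ]distrC.
  exists q => // w /h2 /= [h3 h4]; apply: he; rewrite /f opprD addrACA subrr add0r.
  apply: (le_lt_trans (nrC_leD _)); rewrite /=.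
  by rewrite (splitr e) ltrD.
have -> : [set x : C | nr (x - c) <= r] =
   f @` (`[-r, r] `*` `[-r, r]) `&` [set x : C | nr (x - c) <= r].
  rewrite eqEsubset; split => x; last by case.
  move=> /= hx; split => //.
  exists (complex.Re (x - c), complex.Im (x - c)) => /=.
    rewrite !in_itv /= -!ler_norml.
    by rewrite (le_trans (nrC_Re _) hx) (le_trans (nrC_Im _) hx).
  by rewrite /f /=; case: x {hx} => a b; case: (c) => a' b' /=;
     rewrite /GRing.add /= !subrKC.
apply: compact_closedI.
  apply: continuous_compact; first by apply: continuous_subspaceT.
  by apply: compact_setX; apply: segment_compact.
move=> x; move=> /closure_nrP h /=; apply/ler_addgt0Pl => e e0.
have [w /= hw wx] := h e e0.
have -> : x - c = (x - w) + (w - c) by rewrite addrA subrK.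
apply: (le_trans (nrD _ _)); rewrite lerD // nrB; exact: ltW.
Qed.

End Cmod.

(** * Compact sets and the distance to the complement *)

Section Vec.
Variables (R : realType) (n : nat).
Local Notation C := R[i].
Local Notation T := 'rV[C]_n.

Lemma nr_entry (z : T) i : nr (z 0 i) <= nr z.
Proof.
rewrite -lecR -!nrE [X in _ <= X]/Num.norm /= mx_normE.
rewrite -[leLHS]nngE num_le; exact: (le_bigmax _ _ ((0 : 'I_1), i)).
Qed.

Lemma nr_le (z : T) (r : R) : 0 <= r -> (forall i, nr (z 0 i) <= r) -> nr z <= r.
Proof.
move=> r0 h; rewrite -lecR -nrE [X in X <= _]/Num.norm /=.
have [->|/mx_norm_neq0[[i j] ->]] := eqVneq (mx_norm z) 0; first by rewrite lecR.
by rewrite /= ord1 -nrC_norm lecR.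
Qed.

Lemma closed_bounded_compact (A : set T) (M : R) :
  closed A -> (forall z, A z -> nr z <= M) -> compact A.
Proof.
move=> cA hM.
have -> : A = [set v : T | forall i, [set x : C | nr (x - 0) <= M] (v ord0 i)] `&` A.
  rewrite eqEsubset; split => x; last by case.
  by move=> Ax; split => // i /=; rewrite subr0 (le_trans (nr_entry _ _)) // hM.
apply: compact_closedI => //.
by apply: (@rV_compact _ _ (fun i => [set x : C | nr (x - 0) <= M])) => i; apply: cdisc_compact.
Qed.

End Vec.

Lemma compact_max (R : realType) (V : topologicalType) (f : V -> R) (A : set V) :
  A !=set0 -> compact A -> (forall x, A x -> {for x, continuous f}) ->
  exists2 c, A c & forall x, A x -> f x <= f c.
Proof.
move=> A0 cA hf.
have [|c] := @compact_EVT_max _ _ f A A0 cA.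
  by apply: continuous_in_subspaceT => x /set_mem; apply: hf.
by rewrite inE => Ac hc; exists c => // x Ax; apply: hc; rewrite inE.
Qed.

(** The distance to the complement, for the sup norm of C^n. *)
HB.lock Definition bdist (R : realType) (n : nat) (Omega : set 'rV[R[i]]_n)
  (z : 'rV[R[i]]_n) : R := inf [set nr (p - z) | p in ~` Omega].

Section Dist.
Variables (R : realType) (n : nat).
Local Notation C := R[i].
Local Notation T := 'rV[C]_n.+1.
Variables (Omega : set T) (M : R).
Hypothesis oO : open Omega.
Hypothesis bO : forall z, Omega z -> nr z <= M.

Local Notation bdist := (bdist Omega).

Lemma unbounded_point : exists p, ~ Omega p.
Proof.
exists (const_mx (`|M| + 1)%:C) => /bO h.
have := le_trans (nr_entry (const_mx (`|M| + 1)%:C) ord0) h.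
rewrite mxE nr_real ger0_norm ?addr_ge0 // => h1.
have := ler_norm M; lra.
Qed.

Lemma bdist_has_inf z : has_inf [set nr (p - z) | p in ~` Omega].
Proof.
split; first by have [p hp] := unbounded_point; exists (nr (p - z)), p.
by exists 0 => _ [p _ <-]; apply: nr_ge0.
Qed.

Lemma bdist_le z p : ~ Omega p -> bdist z <= nr (p - z).
Proof. by move=> hp; rewrite unlock; apply: ge_inf; [case: (bdist_has_inf z)|exists p]. Qed.

Lemma le_bdist z (r : R) : (forall p, ~ Omega p -> r <= nr (p - z)) -> r <= bdist z.
Proof.
move=> h; rewrite unlock; apply: lb_le_inf; first by case: (bdist_has_inf z).
by move=> _ [p hp <-]; apply: h.
Qed.

Lemma bdist_lip z w : bdist z <= bdist w + nr (w - z).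
Proof.
rewrite -lerBlDr; apply: le_bdist => p hp; rewrite lerBlDr.
apply: (le_trans (bdist_le z hp)).
by rewrite (le_trans _ (nrD _ _)) // addrA subrK.
Qed.

Lemma bdist_cont : continuous bdist.
Proof. by apply: lip_cont => z w; rewrite lerBlDl nrB bdist_lip. Qed.

Lemma bdist_ball z w : nr (w - z) < bdist z -> Omega w.
Proof. by move=> h; apply: contrapT => /(bdist_le z); rewrite leNgt h. Qed.

Lemma bdist_gt0 z : Omega z <-> 0 < bdist z.
Proof.
split=> [Oz|h]; last by apply: (@bdist_ball z); rewrite subrr nr0.
have /open_nrP/(_ _ Oz)[e e0 he] := oO.
apply: (lt_le_trans e0); apply: le_bdist => p hp; rewrite leNgt; apply/negP.
by move=> /he.
Qed.

(** Only points p no farther than some fixed p0 matter, and these form a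
    compact set. *)
Lemma bdist_nearest z : exists2 p, ~ Omega p & nr (p - z) = bdist z.
Proof.
have [p0 hp0] := unbounded_point.
pose A := [set p | ~ Omega p] `&` [set p : T | nr (p - z) <= nr (p0 - z)].
have cf : continuous (fun p : T => nr (p - z)).
  apply: lip_cont => x w; rewrite lerBlDr (le_trans _ (nrD _ _)) //.
  by rewrite addrA subrK.
have [|||p [hp _] hmin] := @compact_max R T (fun p => - nr (p - z)) A.
- by exists p0; split => //=.
- apply: (@closed_bounded_compact _ _ _ (nr (p0 - z) + nr z)).
    apply: closedI; first exact: open_closedC.
    by have /continuous_closedP/(_ _ (@closed_le R (nr (p0 - z)))) := cf.
  move=> w [_ /= hw]; rewrite -[w in nr w](subrK z).
  by rewrite (le_trans (nrD _ _)) // lerD2r.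
- by move=> x _; apply: continuousN; exact: cf.
exists p => //; apply/eqP; rewrite eq_le bdist_le // andbT.
apply: le_bdist => q hq; have [hq'|hq'] := leP (nr (q - z)) (nr (p0 - z)).
  by rewrite -lerN2 hmin.
rewrite (le_trans _ (ltW hq')) // -lerN2; apply: hmin; split => //=.
Qed.

End Dist.

(** * Plurisubharmonicity in the viscosity sense *)

Section Touch.
Variables (R : realType) (n : nat).
Local Notation C := R[i].
Local Notation T := 'rV[C]_n.
Implicit Types (u v Q : T -> R) (z b : T).

(** On the affine disc of direction b, u is touched from above at z by a
    strictly superharmonic quadratic. *)
Definition touched u z b (al be : C) (eps r : R) :=
  forall x : C, nr x <= r ->
    u (z + x *: b) <= u z + complex.Re (al * x + be * x ^+ 2) - eps * nr x ^+ 2.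

(** Plurisubharmonicity at z in the viscosity sense. It is local and involves
    no integral. For continuous functions on an open set it is equivalent to
    the sub-mean value property on discs ([psh_vpsh], [vpsh_psh]). *)
Definition vpsh u z := forall b al be (eps r : R), 0 < eps -> 0 < r ->
  ~ touched u z b al be eps r.

Lemma small_disc (b : T) (e r : R) : 0 < e -> 0 < r ->
  exists2 r', 0 < r' <= r & forall x : C, nr x <= r' -> nr (x *: b) < e.
Proof.
move=> e0 r0; pose s := e / (nr b + 1).
have b1 : 0 < nr b + 1 by rewrite ltr_wpDl // nr_ge0.
have s0 : 0 < s by rewrite divr_gt0.
exists (Num.min r s); first by rewrite lt_min r0 s0 ge_min lexx.
move=> x; rewrite le_min => /andP[_ hx]; rewrite nrZ.
have : nr x * (nr b + 1) <= e by rewrite -ler_pdivlMr.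
have := nr_ge0 x; have := nr_ge0 b.
have [->|x0] := eqVneq (nr x) 0; first by rewrite !mul0r.
move=> _ hx0; have : 0 < nr x by rewrite lt_neqAle eq_sym x0.
by lra.
Qed.

(** Maxima, gluing and geometric means are all treated through this lemma: at
    each point one exhibits a vpsh function that lies below u and agrees with
    u there. *)
Lemma vpsh_support u v z (e : R) : 0 < e -> vpsh v z -> v z = u z ->
  (forall w, nr (w - z) < e -> v w <= u w) -> vpsh u z.
Proof.
move=> e0 hv vu h b al be eps r eps0 r0 ht.
have [r' /andP[r'0 r'r] hr'] := small_disc b e0 r0.
apply: (hv b al be eps r') => // x hx; rewrite vu.
apply: le_trans (ht x (le_trans hx r'r)); apply: h.
by rewrite addrC addKr; apply: hr'.
Qed.

(** Along each disc, Q is a harmonic affine function plus a nonnegative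
    multiple of |x|^2. The former is absorbed by the test function of
    [touched] and the latter has the right sign, so adding Q preserves [vpsh];
    for a sum of two general vpsh functions this is not immediate. *)
Definition psh_quadratic Q := forall z b, exists ga (H : R), 0 <= H /\
  forall x : C, Q (z + x *: b) = Q z + complex.Re (ga * x) + H * nr x ^+ 2.

Lemma psh_quadratic_cst (c : R) : psh_quadratic (fun=> c).
Proof. by move=> z b; exists 0, 0; split => // x; rewrite !mul0r !addr0. Qed.

Lemma vpsh_quadratic u Q z (a : R) : 0 < a -> psh_quadratic Q -> vpsh u z ->
  vpsh (fun w => a * u w + Q w) z.
Proof.
move=> a0 hQ hu b al be eps r eps0 r0 ht.
have [ga [H [H0 hH]]] := hQ z b.
apply: (hu b (a^-1%:C * (al - ga)) (a^-1%:C * be) (a^-1 * eps) r) => //.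
  by rewrite mulr_gt0 // invr_gt0.
move=> x hx; have := ht x hx; rewrite hH => h.
rewrite -(ler_pM2l a0).
have -> : a^-1%:C * (al - ga) * x + a^-1%:C * be * x ^+ 2 =
   a^-1%:C * ((al * x + be * x ^+ 2) - ga * x) :> C by ring.
rewrite ReM /= mul0r subr0 ReD ReN.
have -> : a * (u z + a^-1 * (complex.Re (al * x + be * x ^+ 2) -
  complex.Re (ga * x)) - a^-1 * eps * nr x ^+ 2) = a * u z +
  (complex.Re (al * x + be * x ^+ 2) - complex.Re (ga * x)) - eps * nr x ^+ 2.
  by field; rewrite gt_eqF.
have : 0 <= H * nr x ^+ 2 by rewrite mulr_ge0 // sqr_ge0.
by lra.
Qed.

Lemma vpsh_shift u z c : vpsh u (z + c) -> vpsh (fun w => u (w + c)) z.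
Proof.
move=> hu b al be eps r eps0 r0 ht; apply: (hu b al be eps r) => // x hx.
by have := ht x hx; rewrite addrAC.
Qed.

End Touch.

(** * Polynomials in one complex variable *)

Section Poly.
Variables (R : realType).
Local Notation C := R[i].

Lemma poly_taylor2 (p : {poly C}) (x0 : C) : exists c1 c2 : C, exists2 K : R, 0 <= K &
  forall h : C, nr h <= 1 ->
   nr (p.[x0 + h] - p.[x0] - c1 * h - c2 * h ^+ 2) <= K * nr h ^+ 3.
Proof.
elim/poly_ind: p => [|p c [c1 [c2 [K K0 hK]]]].
  by exists 0, 0, 0 => // h _; rewrite !horner0 !mul0r !subr0 nr0.
exists (c1 * x0 + p.[x0]), (c2 * x0 + c1), (nr c2 + K * (nr x0 + 1)).
  by rewrite addr_ge0 ?nr_ge0 // mulr_ge0 // addr_ge0 // nr_ge0.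
move=> h h1; rewrite !hornerMXaddC.
set e := p.[x0 + h] - p.[x0] - c1 * h - c2 * h ^+ 2 in hK *.
have -> : p.[x0 + h] * (x0 + h) + c - (p.[x0] * x0 + c) -
   (c1 * x0 + p.[x0]) * h - (c2 * x0 + c1) * h ^+ 2 = c2 * h ^+ 3 + e * (x0 + h).
  by rewrite /e; ring.
apply: (le_trans (nrD _ _)); rewrite [leRHS]mulrDl.
apply: lerD.
  by rewrite nrCM nrCX.
rewrite nrCM -mulrA [_ * nr h ^+ 3]mulrC mulrA ler_pM ?nr_ge0 ?hK //.
by rewrite (le_trans (nrD _ _)) // lerD2l.
Qed.

Lemma poly_lip (p : {poly C}) (x0 : C) : exists2 K : R, 0 <= K &
  forall h : C, nr h <= 1 -> nr (p.[x0 + h] - p.[x0]) <= K * nr h.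
Proof.
have [c1 [c2 [K K0 hK]]] := poly_taylor2 p x0.
exists (nr c1 + nr c2 + K); first by rewrite !addr_ge0 ?nr_ge0.
move=> h h1; have := hK h h1.
set d := p.[x0 + h] - p.[x0] => hd.
have -> : d = (d - c1 * h - c2 * h ^+ 2) + (c1 * h + c2 * h ^+ 2) by ring.
have h0 := nr_ge0 h.
have h21 : nr h ^+ 2 <= nr h by rewrite expr2 ler_piMl.
have h31 : nr h ^+ 3 <= nr h by rewrite exprSr (le_trans _ h21) // expr2 ler_wpM2r.
apply: (le_trans (nrD _ _)); rewrite !mulrDl [leRHS]addrC lerD //.
  by apply: (le_trans hd); rewrite ler_wpM2l.
apply: (le_trans (nrD _ _)); rewrite lerD ?nrCM ?nrCX // ler_wpM2l ?nr_ge0 //.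
Qed.

(** A polynomial substitute for exp (- (al x + be x^2)). With
    X = - (al x + be x^2) and P = (1 + X/k)^k one has
    |1 + X/k|^2 = 1 + 2 Re X / k + |X|^2 / k^2
                <= exp (2 Re X / k + |X|^2 / k^2),
    so |P| exceeds exp (Re X) by at most the factor exp (|X|^2 / 2k), which
    eps absorbs when k is large. *)
Lemma touch_poly (al be : C) (eps : R) : 0 < eps ->
  exists P : {poly C}, exists2 r0 : R, 0 < r0 & P.[0] = 1 /\
   forall x, nr x <= r0 -> nr (P.[x] - 1) <= 4^-1 /\
     nr P.[x] <= expR (- complex.Re (al * x + be * x ^+ 2) + eps / 2 * nr x ^+ 2).
Proof.
move=> eps0; pose A := nr al + nr be.
have A0 : 0 <= A by rewrite addr_ge0 ?nr_ge0.
pose m := (Num.truncn (A ^+ 2 / eps)).+1.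
have hm : A ^+ 2 / eps <= m%:R by apply/ltW; rewrite -truncn_le_nat // divr_ge0 ?sqr_ge0 // ltW.
have m0 : (0 : R) < m%:R by rewrite ltr0n.
pose c : C := (m%:R^-1)%:C.
have hE := (horner_exp, hornerD, hornerN, hornerZ, hornerX, hornerXn, hornerC).
pose P : {poly C} := (1 - c *: (al *: 'X + be *: 'X^2)) ^+ m.
have P0 : P.[0] = 1 by rewrite /P !hE expr0n /= !mulr0 addr0 mulr0 subr0 expr1n.
have [K K0 hK] := poly_lip P 0.
pose r0 := Num.min 1 (4^-1 / (K + 1)).
have K1 : 0 < K + 1 by lra.
exists P, r0; first by rewrite lt_min ltr01 divr_gt0.
split => // x; rewrite le_min => /andP[x1 xK].
split.
  have := hK x x1; rewrite add0r P0 => h; apply: (le_trans h).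
  have : nr x * (K + 1) <= 4^-1 by rewrite -ler_pdivlMr.
  by have := nr_ge0 x; lra.
set X := al * x + be * x ^+ 2.
have hX : nr X <= A * nr x.
  rewrite /X /A mulrDl (le_trans (nrD _ _)) // lerD // nrCM // nrCX.
  by rewrite ler_wpM2l ?nr_ge0 // expr2 ler_piMl // nr_ge0.
have -> : P.[x] = (1 - c * X) ^+ m by rewrite /P !hE.
rewrite -(@ler_pXn2r _ 2) ?nnegrE ?nr_ge0 ?expR_ge0 // nrCX exprAC.
rewrite -expRM_natl.
have h1 : nr (1 - c * X) ^+ 2 <= expR (- 2 * complex.Re X / m%:R + nr X ^+ 2 / m%:R ^+ 2).
  apply: le_trans (expR_ge1Dx _).
  rewrite !nrC_sqr ReD ImD ReN ImN ReM ImM /=.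
  by rewrite le_eqVlt; apply/orP; left; apply/eqP; field; rewrite gt_eqF.
apply: (le_trans (lerXn2r m _ _ h1)); rewrite ?nnegrE ?expR_ge0 ?sqr_ge0 //.
rewrite -expRM_natl ler_expR.
have -> : m%:R * (- 2 * complex.Re X / m%:R + nr X ^+ 2 / m%:R ^+ 2) =
  - 2 * complex.Re X + nr X ^+ 2 / m%:R.
  by field; rewrite gt_eqF.
have : nr X ^+ 2 / m%:R <= eps * nr x ^+ 2.
  rewrite ler_pdivrMr // (@le_trans _ _ (A ^+ 2 * nr x ^+ 2)) //.
    by rewrite -exprMn ler_pXn2r ?nnegrE ?nr_ge0 // mulr_ge0 // nr_ge0.
  rewrite [leRHS]mulrAC ler_wpM2r ?sqr_ge0 //.
  by rewrite -ler_pdivrMl // mulrC.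
by lra.
Qed.

End Poly.

(** * Oka's theorem on the distance to the complement *)

Section Oka.
Variables (R : realType) (n : nat).
Local Notation C := R[i].
Local Notation T := 'rV[C]_n.+1.

Lemma cont2_lip (F : C -> C -> T) (x0 y0 : C) (K : R) :
  (forall h k, nr h <= 1 -> nr k <= 1 ->
     nr (F (x0 + h) (y0 + k) - F x0 y0) <= K * (nr h + nr k)) ->
  {for (x0, y0), continuous (fun p : C * C => F p.1 p.2)}.
Proof.
move=> h A /nbhs_nrP[e e0 he].
have K1 : 0 < `|K| + 1 by rewrite ltr_wpDl.
pose d := Num.min 1 (e / (`|K| + 1) / 2).
have d0 : 0 < d by rewrite lt_min ltr01 !divr_gt0.
exists ([set x | nr (x - x0) < d], [set y | nr (y - y0) < d]) => /=.
  by split; apply/nbhs_nrP; exists d.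
move=> [x y] /= []; rewrite !lt_min => /andP[x1 xd] /andP[y1 yd].
apply: he => /=; rewrite -[x](subrKC x0) -[y](subrKC y0).
have [xx yy] : nr (x - x0) <= 1 /\ nr (y - y0) <= 1 by split; apply: ltW.
have s0 : nr (x - x0) + nr (y - y0) < e / (`|K| + 1) by rewrite [ltRHS]splitr ltrD.
apply: (le_lt_trans (h _ _ xx yy)).
have := nr_ge0 (x - x0); have := nr_ge0 (y - y0).
move: s0; rewrite ltr_pdivlMr //; set s := _ + _ => s1 s2 s3.
have s4 : 0 <= s by rewrite addr_ge0.
have s5 : K * s <= `|K| * s by rewrite ler_wpM2r // ler_norm.
lra.
Qed.

(** As Re y >= k / 2 and P is close to 1, twice the real part of conj(P) y
    exceeds |y|^2, which is of order k^2. *)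
Lemma disc_close (P y : C) (k : R) : nr (P - 1) <= 4^-1 -> 0 < k -> k <= 9^-1 ->
  nr (y - k%:C) <= k / 2 -> nr (P - y) < nr P.
Proof.
move=> hP k0 k9 hy.
have hP1 := le_trans (nrC_Re _) hP; have hP2 := le_trans (nrC_Im _) hP.
have hy1 := le_trans (nrC_Re _) hy; have hy2 := le_trans (nrC_Im _) hy.
rewrite -(@ltr_pXn2r _ 2) ?nnegrE ?nr_ge0 //.
rewrite !nrC_sqr ReD ImD ReN ImN.
case: P {hP} hP1 hP2 => a b; case: y {hy} hy1 hy2 => c d /=.
rewrite oppr0 !addr0 !ler_norml => /andP[c1 c2] /andP[d1 d2] /andP[a1 a2] /andP[b1 b2].
have h1 : 3 / 8 * k <= a * c by nra.
have h2 : - (k / 8) <= b * d by nra.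
have h3 : c ^+ 2 <= 9 / 4 * k ^+ 2 by nra.
have h4 : d ^+ 2 <= 1 / 4 * k ^+ 2 by nra.
have h5 : k ^+ 2 <= k / 9 by rewrite expr2 ler_wpM2l // ltW.
nra.
Qed.

Variables (Omega : set T) (M : R).
Hypothesis oO : open Omega.
Hypothesis bO : forall z, Omega z -> nr z <= M.
Local Notation d := (bdist Omega).

Lemma bdist_ge_compact (c : R) : 0 < c -> compact [set z | c <= d z].
Proof.
move=> c0; apply: (@closed_bounded_compact _ _ _ M).
  by have /continuous_closedP/(_ _ (@closed_ge R c)) := @bdist_cont _ _ _ _ bO.
by move=> z /= hz; apply: bO; apply/(bdist_gt0 oO bO); apply: lt_le_trans hz.
Qed.

Variable phi : T -> R.
Hypothesis cphi : forall z, Omega z -> {for z, continuous phi}.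
Hypothesis vphi : forall z, Omega z -> vpsh phi z.
Hypothesis ephi : forall c : R, rel_compact_in [set z | Omega z /\ phi z < c] Omega.

Lemma exhaustion_blowup p (c : R) : ~ Omega p ->
  exists2 e, 0 < e & forall z, Omega z -> nr (z - p) < e -> c <= phi z.
Proof.
move=> hp; have [_ hc] := ephi c.
have : ~ closure [set z | Omega z /\ phi z < c] p by move/hc.
move=> /closure_nrP/existsNP[e /not_implyP[e0 he]].
exists e => // z Oz hz; rewrite leNgt; apply/negP => hlt.
by apply: he; exists z.
Qed.

Lemma bounded_inside (c : R) : 0 < c -> exists S : R, forall z, c <= d z -> phi z <= S.
Proof.
move=> c0; have [[z hz]|hn] := pselect (exists z, c <= d z).
  have [||w _ hw] := compact_max _ (bdist_ge_compact c0) (f := phi).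
  - by exists z.
  - by move=> w /= hw; apply: cphi; apply/(bdist_gt0 oO bO); apply: lt_le_trans hw.
  by exists (phi w).
by exists 0 => z hz; case: hn; exists z.
Qed.

(** Oka's theorem. Suppose that - ln d is touched from above at z along b. By
    [touch_poly] this says d(z + x b) >= d(z) |P(x)| exp (eps |x|^2 / 2) near
    x = 0 for a polynomial P with P(0) = 1. Let w lead from z to a nearest
    point z + w outside Omega. The discs x |-> G(x, y) = z + x b + (P(x) - y) w
    with y near a small k > 0 lie in Omega, stay in a fixed compact set over
    |x| = r2, but at x = 0 come as close to z + w as desired. So phi has an
    interior maximum in x, contrary to the maximum principle.

    The discs are curved whereas [vpsh] only tests affine ones. This is why
    phi(G(x, y)) + e' |x|^2 - B |y - k|^2 is maximised in x and y together:
    at an interior maximum (x0, y0), letting y follow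
    y0 + P(x) - P(x0) - c1 (x - x0), where c1 = P'(x0), makes
    x |-> G(x, y) affine. As y moves only to second order, and its second order
    part is harmonic, the penalty does not destroy the gain - e' |x|^2, and phi
    is touched from above. *)
Lemma oka_psh z : Omega z -> vpsh (fun w => - ln (d w)) z.
Proof.
move=> Oz b al be eps r eps0 r0 ht.
have dz0 : 0 < d z by apply/(bdist_gt0 oO bO).
have [P [r1 r1_0 [P0 hP]]] := touch_poly al be eps0.
have [||r2 /andP[r20 r2r] hr2] := @small_disc _ _ b (d z / 2) (Num.min r r1).
- by rewrite divr_gt0.
- by rewrite lt_min r0.
have {r2r} [r2r r2r1] : r2 <= r /\ r2 <= r1 by move: r2r; rewrite le_min => /andP.
have dxb (x : C) : nr x <= r2 -> d z / 2 < d (z + x *: b).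
  move=> /hr2 h; have := bdist_lip bO z (z + x *: b).
  by rewrite [z + _]addrC addrK; lra.
have key (x : C) : nr x <= r2 ->
    d z * nr P.[x] * expR (eps / 2 * nr x ^+ 2) <= d (z + x *: b).
  move=> hx; have dx0 : 0 < d (z + x *: b) by apply: lt_trans (dxb x hx); rewrite divr_gt0.
  have [_ hPx] := hP x (le_trans hx r2r1).
  apply: (@le_trans _ _ (d z * expR (- complex.Re (al * x + be * x ^+ 2) + eps / 2 * nr x ^+ 2)
     * expR (eps / 2 * nr x ^+ 2))).
    by rewrite ler_wpM2r ?expR_ge0 // ler_wpM2l // ltW.
  rewrite -mulrA -expRD -[d z]lnK ?posrE // -expRD -[leRHS]lnK ?posrE // ler_expR.
  by have := ht x (le_trans hx r2r); lra.
have [p hp pd] := bdist_nearest oO bO z.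
pose w := p - z.
pose G (x y : C) : T := z + x *: b + (P.[x] - y) *: w.
have Gnear x y : nr (G x y - (z + x *: b)) = nr (P.[x] - y) * d z.
  by rewrite /G addrC addKr nrZ pd.
have GO (x y : C) : nr x <= r2 -> nr (P.[x] - y) < nr P.[x] -> Omega (G x y).
  move=> hx hxy; apply: (@bdist_ball _ _ _ _ bO (z + x *: b)); rewrite Gnear.
  apply: lt_le_trans (key x hx); rewrite mulrC -mulrA ltr_pM2l //.
  apply: (lt_le_trans hxy); rewrite ler_peMr ?nr_ge0 // -[leLHS]expR0 ler_expR.
  by rewrite mulr_ge0 ?sqr_ge0 // divr_ge0 // ltW.
(* The factor exp (eps r2^2 / 2) leaves room c0 over the circle |x| = r2. *)
pose c0 := (1 - expR (- (eps / 2 * r2 ^+ 2))) * (d z / 2).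
have er0 : 0 < eps / 2 * r2 ^+ 2 by rewrite mulr_gt0 ?divr_gt0 // exprn_gt0.
have c00 : 0 < c0.
  by rewrite mulr_gt0 ?divr_gt0 // subr_gt0 -[ltRHS]expR0 ltr_expR oppr_lt0.
have Gin (x y : C) : nr x = r2 -> nr (P.[x] - y) <= nr P.[x] -> c0 <= d (G x y).
  move=> hx hxy; have hx' : nr x <= r2 by rewrite hx.
  have := bdist_lip bO (z + x *: b) (G x y); rewrite Gnear => h1.
  have := key x hx'; rewrite hx => h2.
  have h3 := dxb x hx'.
  have h4 : nr (P.[x] - y) * d z <= d (z + x *: b) * expR (- (eps / 2 * r2 ^+ 2)).
    rewrite expRN ler_pdivlMr ?expR_gt0 //.
    apply: le_trans h2; rewrite ler_wpM2r ?expR_ge0 // mulrC ler_wpM2l //; exact: ltW.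
  have h5 : c0 <= (1 - expR (- (eps / 2 * r2 ^+ 2))) * d (z + x *: b).
    rewrite /c0 ler_wpM2l ?(ltW h3) // subr_ge0 -[leRHS]expR0 ler_expR oppr_le0.
    exact: ltW.
  lra.
have [M1 hM1] := bounded_inside c00.
have [e e0 he] := exhaustion_blowup (M1 + 2) hp.
(* The centre G(0, k) = z + (1 - k) w is at distance k d(z) < e from p. *)
pose k := Num.min 9^-1 (e / d z / 2).
have k0 : 0 < k by rewrite lt_min invr_gt0 ltr0n !divr_gt0.
have k9 : k <= 9^-1 by rewrite ge_min lexx.
have clo (x y : C) : nr x <= r2 -> nr (y - k%:C) <= k / 2 -> nr (P.[x] - y) < nr P.[x].
  move=> hx hy; apply: (disc_close _ k0 k9 hy).
  by have [] := hP x (le_trans hx r2r1).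
have nr0C : nr (0 : C) = 0 by rewrite nr0.
have k20 : 0 <= k / 2 by rewrite divr_ge0 // ltW.
have c0k : nr (k%:C - k%:C : C) <= k / 2 by rewrite subrr nr0C.
have n0r2 : nr (0 : C) <= r2 by rewrite nr0C ltW.
have G0k : M1 + 2 <= phi (G 0 k%:C).
  apply: he; first by apply: GO => //; apply: clo.
  rewrite /G scale0r addr0 P0 scalerBl scale1r.
  have -> : z + (w - k%:C *: w) - p = - (k%:C *: w).
    by apply/rowP => i; rewrite /w !mxE; ring.
  rewrite nrN nrZ pd nr_real gtr0_norm // -ltr_pdivlMr //.
  by rewrite gt_min; apply/orP; right; rewrite gtr_pMr ?divr_gt0 //; lra.
pose D := [set x : C | nr (x - 0) <= r2] `*` [set y : C | nr (y - k%:C) <= k / 2].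
have cD : compact D by apply: compact_setX; apply: cdisc_compact.
have DE (x y : C) : D (x, y) <-> nr x <= r2 /\ nr (y - k%:C) <= k / 2.
  by rewrite /D /setX /= subr0.
have D0 : D (0, k%:C) by apply/DE.
have cG q : D q -> {for q, continuous (fun q : C * C => phi (G q.1 q.2))}.
  case: q => x y /DE[hx hy].
  apply: (@continuous_comp _ _ _ (fun q : C * C => G q.1 q.2) phi); last first.
    by apply: cphi; apply: GO => //; apply: clo.
  have [K K0 hK] := poly_lip P x.
  apply: (@cont2_lip _ _ _ (nr b + (K + 1) * nr w)) => h' k' hh kk.
  have -> : G (x + h') (y + k') - G x y = h' *: b + (P.[x + h'] - P.[x] - k') *: w.
    apply/rowP => i; rewrite /G !mxE; ring.
  apply: (le_trans (nrD _ _)); rewrite !nrZ mulrDl lerD //.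
    by rewrite mulrC ler_wpM2l ?nr_ge0 // lerDl nr_ge0.
  rewrite mulrAC ler_wpM2r ?nr_ge0 //; apply: (le_trans (nrD _ _)); rewrite nrN.
  have := hK h' hh; have := nr_ge0 h'; have := nr_ge0 k'.
  have := mulr_ge0 K0 (nr_ge0 k'); lra.
have [|q1 _ hq1] := compact_max _ cD cG; first by exists (0, k%:C).
pose S := phi (G q1.1 q1.2).
have hS (x y : C) : nr x <= r2 -> nr (y - k%:C) <= k / 2 -> phi (G x y) <= S.
  by move=> hx hy; apply: (hq1 (x, y)); apply/DE.
pose e' := r2 ^- 2.
have e'0 : 0 < e' by rewrite invr_gt0 exprn_gt0.
(* With this B the penalty is S - M1 on the rim |y - k| = k / 2. *)
pose B := 4 * (S - M1) / k ^+ 2.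
have SM : M1 + 2 <= S by apply: (le_trans G0k); apply: hS.
have B0 : 0 <= B by rewrite divr_ge0 ?sqr_ge0 // mulr_ge0 // subr_ge0; lra.
pose Psi (q : C * C) := phi (G q.1 q.2) + (e' * nr q.1 ^+ 2 - B * nr (q.2 - k%:C) ^+ 2).
have cPsi q : D q -> {for q, continuous Psi}.
  move=> Dq; apply: cvgD; first exact: cG.
  have cc (f : C * C -> C) (c : R) : {for q, continuous f} ->
      {for q, continuous (fun q => c * nr (f q) ^+ 2)}.
    move=> cf; apply: cvgM; first exact: cvg_cst.
    by apply: cvgM; apply: (@continuous_comp _ _ _ f (@nr R C)) => //; exact: cont_nr.
  apply: cvgB; first by apply: (cc fst); exact: cvg_fst.
  apply: (cc (fun q => q.2 - k%:C)).
  apply: (@continuous_comp _ _ _ snd (fun y : C => y - k%:C)); first exact: cvg_snd.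
  apply/contV_nrP => e1 e10; exists e1 => // w0.
  by rewrite opprB addrA subrK.
have [|[x0 y0] Dq hmax] := compact_max _ cD cPsi; first by exists (0, k%:C).
have [hx0 hy0] := (DE x0 y0).1 Dq.
have hmax' (x y : C) : nr x <= r2 -> nr (y - k%:C) <= k / 2 ->
    phi (G x y) + (e' * nr x ^+ 2 - B * nr (y - k%:C) ^+ 2) <=
    phi (G x0 y0) + (e' * nr x0 ^+ 2 - B * nr (y0 - k%:C) ^+ 2).
  by move=> hx hy; apply: (hmax (x, y)); apply/DE.
have big : M1 + 2 <= phi (G x0 y0) + (e' * nr x0 ^+ 2 - B * nr (y0 - k%:C) ^+ 2).
  apply: (le_trans _ (hmax' 0 k%:C _ _)) => //.
  by rewrite subrr nr0C expr0n /= !mulr0 subrr addr0.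
have er2 : e' * r2 ^+ 2 = 1 by rewrite mulVf // expf_neq0 // gt_eqF.
have er2x : e' * nr x0 ^+ 2 <= 1.
  by rewrite -er2 ler_wpM2l ?(ltW e'0) // ler_pXn2r ?nnegrE ?nr_ge0 //; exact: ltW.
have hx0' : nr x0 < r2.
  rewrite lt_neqAle hx0 andbT; apply/eqP => xr2.
  have h1 : phi (G x0 y0) <= M1.
    by apply: hM1; apply: Gin => //; apply/ltW/clo.
  have : 0 <= B * nr (y0 - k%:C) ^+ 2 by rewrite mulr_ge0 ?sqr_ge0.
  lra.
have hy0' : nr (y0 - k%:C) < k / 2.
  rewrite lt_neqAle hy0 andbT; apply/eqP => yk.
  have h1 := hS x0 y0 hx0 hy0.
  have : B * nr (y0 - k%:C) ^+ 2 = S - M1.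
    by rewrite yk /B; field; rewrite gt_eqF.
  lra.
have [c1 [c2 [K K0 hK]]] := poly_taylor2 P x0.
pose v := y0 - k%:C.
pose K3 := B * (2 * nr v * K + (nr c2 + K) ^+ 2).
have c2K : 0 <= nr c2 + K by rewrite addr_ge0 ?nr_ge0.
have K30 : 0 <= K3.
  by rewrite mulr_ge0 // addr_ge0 ?sqr_ge0 // !mulr_ge0 ?nr_ge0.
pose r' := Num.min (Num.min 1 (r2 - nr x0))
  (Num.min ((k / 2 - nr v) / (nr c2 + K + 1)) (e' / 2 / (K3 + 1))).
have r'0 : 0 < r'.
  rewrite !lt_min ltr01 subr_gt0 hx0' /= !divr_gt0 ?subr_gt0 //.
  - by rewrite ltr_wpDl.
  - by rewrite ltr_wpDl.
apply: (vphi (GO _ _ hx0 (clo _ _ hx0 hy0)) (b := b + c1 *: w)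
   (al := (- 2 * e')%:C * x0^*%C) (be := (2 * B)%:C * (v^*%C * c2))
   (eps := e' / 2) (r := r')) => //.
  by rewrite divr_gt0.
move=> h; rewrite !le_min => /andP[/andP[h1 hr]] /andP[hv hk3].
pose dl := P.[x0 + h] - P.[x0] - c1 * h.
have hdl : nr (dl - c2 * h ^+ 2) <= K * nr h ^+ 3 := hK h h1.
have h0 := nr_ge0 h.
have h21 : nr h ^+ 2 <= nr h by rewrite expr2 ler_piMl.
have h32 : nr h ^+ 3 <= nr h ^+ 2 by rewrite exprSr ler_piMr ?sqr_ge0.
have h43 : nr h ^+ 4 <= nr h ^+ 3 by rewrite exprSr ler_piMr // exprn_ge0.
have hdl2 : nr dl <= (nr c2 + K) * nr h ^+ 2.
  rewrite -[dl](subrK (c2 * h ^+ 2)) (le_trans (nrD _ _)) // nrCM nrCX.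
  have := ler_wpM2l K0 h32; lra.
(* This choice of y makes the disc affine. *)
have hG : G (x0 + h) (y0 + dl) = G x0 y0 + h *: (b + c1 *: w).
  by apply/rowP => i; rewrite /G /dl !mxE; ring.
have hin : nr (x0 + h) <= r2 by apply: (le_trans (nrD _ _)); lra.
have hyk : nr (y0 + dl - k%:C) <= k / 2.
  rewrite addrAC; apply: (le_trans (nrD _ _)).
  move: hv; rewrite ler_pdivlMr ?ltr_wpDl // => hv.
  have h22 : (nr c2 + K) * nr h ^+ 2 <= (nr c2 + K) * nr h by rewrite ler_wpM2l.
  rewrite -/v; lra.
have := hmax' _ _ hin hyk; rewrite hG.
have -> : y0 + dl - k%:C = v + dl by rewrite addrAC.
rewrite -/v (nrC_sqrD x0 h) (nrC_sqrD v dl).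
have -> : complex.Re ((- 2 * e')%:C * x0^*%C * h + (2 * B)%:C * (v^*%C * c2) * h ^+ 2) =
   - 2 * e' * complex.Re (x0^*%C * h) + 2 * B * complex.Re (v^*%C * (c2 * h ^+ 2)).
  have -> : (2 * B)%:C * (v^*%C * c2) * h ^+ 2 = (2 * B)%:C * (v^*%C * (c2 * h ^+ 2)) by ring.
  by rewrite ReD -mulrA !ReZ.
have e1 : complex.Re (v^*%C * dl) <= complex.Re (v^*%C * (c2 * h ^+ 2)) + nr v * (K * nr h ^+ 3).
  have -> : v^*%C * dl = v^*%C * (c2 * h ^+ 2) + v^*%C * (dl - c2 * h ^+ 2) by ring.
  rewrite ReD lerD2l (le_trans (ler_norm _)) // (le_trans (nrC_Re _)) // nrCM.
  rewrite nrC_conj.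
  by rewrite ler_wpM2l ?nr_ge0.
have e2 : nr dl ^+ 2 <= (nr c2 + K) ^+ 2 * nr h ^+ 3.
  apply: (@le_trans _ _ ((nr c2 + K) ^+ 2 * nr h ^+ 4)); last by rewrite ler_wpM2l ?sqr_ge0.
  have -> : (nr c2 + K) ^+ 2 * nr h ^+ 4 = ((nr c2 + K) * nr h ^+ 2) ^+ 2 by ring.
  by rewrite ler_pXn2r ?nnegrE ?nr_ge0 // mulr_ge0 // sqr_ge0.
have e3 : B * (2 * complex.Re (v^*%C * dl) + nr dl ^+ 2) <=
    2 * B * complex.Re (v^*%C * (c2 * h ^+ 2)) + K3 * nr h ^+ 3.
  have -> : 2 * B * complex.Re (v^*%C * (c2 * h ^+ 2)) + K3 * nr h ^+ 3 =
    B * (2 * (complex.Re (v^*%C * (c2 * h ^+ 2)) + nr v * (K * nr h ^+ 3)) +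
     (nr c2 + K) ^+ 2 * nr h ^+ 3) by rewrite /K3; ring.
  by rewrite ler_wpM2l // lerD // ler_wpM2l.
have e4 : K3 * nr h ^+ 3 <= e' / 2 * nr h ^+ 2.
  rewrite exprSr mulrA mulrAC ler_wpM2r ?sqr_ge0 //.
  by move: hk3; rewrite ler_pdivlMr ?ltr_wpDl //; lra.
move: e3; rewrite mulrDr; lra.
Qed.

End Oka.

(** * The maximum principle on affine discs *)

Section MaxPrinciple.
Variables (R : realType) (n : nat).
Local Notation C := R[i].
Local Notation T := 'rV[C]_n.

Lemma disc_cont (u : T -> R) (a b : T) (x : C) :
  {for a + x *: b, continuous u} -> {for x, continuous (fun x : C => u (a + x *: b))}.
Proof.
move=> cu; apply: (@continuous_comp _ _ _ (fun x : C => a + x *: b) u) => //.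
apply/contV_nrP => e e0; have [d /andP[d0 _] hd] := small_disc b e0 ltr01.
exists d => // w hw; have -> : a + w *: b - (a + x *: b) = (w - x) *: b.
  by rewrite opprD addrACA subrr add0r scalerBl.
exact/hd/ltW.
Qed.

Lemma cont_Re_poly (f : {poly C}) : continuous (fun x : C => complex.Re f.[x]).
Proof.
move=> x; apply: (@continuous_comp _ _ _ (fun x : C => f.[x]) (@complex.Re R)); last exact: cont_Re.
apply/contV_nrP => e e0; have [K K0 hK] := poly_lip f x.
have K1 : 0 < K + 1 by rewrite ltr_wpDl.
exists (Num.min 1 (e / (K + 1))); first by rewrite lt_min ltr01 divr_gt0.
move=> w; rewrite lt_min => /andP[w1]; rewrite ltr_pdivlMr // => we.
have := hK _ (ltW w1); rewrite subrKC => h; apply: (le_lt_trans h).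
by have := nr_ge0 (w - x); lra.
Qed.

(** If u exceeded Re f at the centre of the disc, then u - Re f + s/2 |x|^2
    would have an interior maximum for small s > 0, and there the expansion of
    f to second order touches u from above. *)
Lemma vpsh_max_principle (u : T -> R) (a b : T) (f : {poly C}) :
  (forall x : C, nr x <= 1 -> {for a + x *: b, continuous u}) ->
  (forall x : C, nr x <= 1 -> vpsh u (a + x *: b)) ->
  (forall x : C, nr x = 1 -> u (a + x *: b) <= complex.Re f.[x]) ->
  u a <= complex.Re f.[0].
Proof.
move=> cu vu hf; rewrite leNgt; apply/negP => hlt.
pose s := u a - complex.Re f.[0].
have s0 : 0 < s by rewrite subr_gt0.
pose Psi (x : C) := u (a + x *: b) - complex.Re f.[x] + s / 2 * nr x ^+ 2.
pose D := [set x : C | nr (x - 0) <= 1].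
have cPsi x : D x -> {for x, continuous Psi}.
  move=> Dx; have hx : nr x <= 1 by move: Dx; rewrite /D /= subr0.
  apply: contD_at.
    by apply: contB_at; [apply: disc_cont; exact: cu|exact: cont_Re_poly].
  by apply: contM_at; [exact: cst_continuous|apply: contM_at; exact: cont_nr].
have [|x0] := compact_max _ (@cdisc_compact R 0 1) cPsi.
  by exists 0; rewrite /D /= subr0 nr0.
rewrite /D /= subr0 => hx0 hmax.
have P0 : s <= Psi x0.
  apply: (le_trans _ (hmax 0 _)); last by rewrite subr0 nr0.
  by rewrite /Psi scale0r addr0 nr0 expr0n /= mulr0 addr0.
clearbody s.
have hx1 : nr x0 < 1.
  rewrite lt_neqAle hx0 andbT; apply/eqP => x1; move: P0.
  by rewrite /Psi x1 expr1n; have := hf x0 x1; lra.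
have [c1 [c2 [K K0 hK]]] := poly_taylor2 f x0.
have K1 : 0 < K + 1 by rewrite ltr_wpDl.
pose r := Num.min (1 - nr x0) (s / 4 / (K + 1)).
apply: (vu x0 hx0 b (c1 - s%:C * x0^*%C) c2 (s / 4) r).
- by rewrite divr_gt0.
- by rewrite lt_min subr_gt0 hx1 !divr_gt0.
move=> h; rewrite le_min => /andP[h1 hK']; have h0 := nr_ge0 h.
have h1' : nr h <= 1 by have := nr_ge0 x0; lra.
have := hmax (x0 + h); rewrite subr0 => /(_ _)/wrap[].
  by apply: (le_trans (nrD _ _)); lra.
rewrite /Psi nrC_sqrD scalerDl addrA => hm.
have := le_trans (ler_norm _) (le_trans (nrC_Re _) (hK h h1')).
rewrite !(ReD, ReN, mulrBl) => hk.
have e4 : K * nr h ^+ 3 <= s / 4 * nr h ^+ 2.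
  rewrite exprSr mulrA mulrAC ler_wpM2r ?sqr_ge0 //.
  by move: hK'; rewrite ler_pdivlMr //; lra.
have -> : complex.Re (s%:C * x0^*%C * h) = s * complex.Re (x0^*%C * h).
  by rewrite -mulrA ReZ.
move: (complex.Re (x0^*%C * h)) hm hk => X.
move: (complex.Re f.[_]) (complex.Re f.[_]) (complex.Re (c1 * h)) (complex.Re (c2 * _)).
move: (u _) (u _) e4; move: (K * _); move: (nr h ^+ 2) (nr x0 ^+ 2) => H X0 KK u1 u2.
move=> e4 f1 f2 cc1 cc2 hm hk; lra.
Qed.

End MaxPrinciple.

(** * Discrete Fejer means *)

Section Fejer.
Variables (R : realType).
Local Notation C := R[i].

Lemma expiD (s t : R) : expi (s + t) = expi s * expi t.
Proof.
rewrite /expi cosD sinD; apply/eqP; rewrite eq_complex /=.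
by rewrite eqxx /= addrC.
Qed.

Lemma expi0 : expi 0 = 1 :> C.
Proof. by rewrite /expi cos0 sin0. Qed.

Lemma expiX (t : R) k : expi t ^+ k = expi (k%:R * t).
Proof.
elim: k => [|k IH]; first by rewrite mul0r expi0.
by rewrite exprS IH -expiD; congr expi; rewrite -natr1; ring.
Qed.

Lemma conj_mul_unit (y : C) : nr y = 1 -> y^*%C * y = 1.
Proof.
move=> hy; have := nrC_sqr y; rewrite hy expr1n; case: y {hy} => c d /= h.
by apply/eqP; rewrite eq_complex /=; apply/andP; split; apply/eqP; [rewrite h; ring|ring].
Qed.

Lemma expi_neq1 (t : R) : 0 < t < 2 * pi -> expi t != 1 :> C.
Proof.
move=> /andP[t0 t2]; apply/eqP => /(congr1 (@complex.Re R)) /=.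
have -> : t = (t / 2) *+ 2 by rewrite -mulr_natr; field.
rewrite cos_mulr2n => h.
have : 0 < sin (t / 2) by apply: sin_gt0_pi; rewrite divr_gt0 //= ltr_pdivrMr // mulrC.
have := cos2Dsin2 (t / 2); nra.
Qed.

(** A polynomial whose real part on the unit circle is the Dirichlet kernel
    1 + 2 cos t + ... + 2 cos (N t). *)
Definition dirichlet (N : nat) : {poly C} := 1 + 2 *: \sum_(j < N) 'X^(j.+1).
(** On the unit circle, the real part is N times the Fejer kernel. *)
Definition fejer (N : nat) : {poly C} := \sum_(m < N) dirichlet m.

(** The sum S of the first N powers satisfies
    |S + y^N|^2 - |S|^2 = 1 + 2 Re (conj(S) y^N), and on the circle
    conj(S) y^N = y + ... + y^N: this is the N-th Dirichlet kernel. *)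
Lemma fejer_sqr N (y : C) : nr y = 1 ->
  complex.Re (fejer N).[y] = nr (\sum_(j < N) y ^+ j) ^+ 2.
Proof.
move=> y1; elim: N => [|N IH].
  by rewrite /fejer !big_ord0 horner0 nr0 expr0n.
rewrite /fejer big_ord_recr /= hornerD ReD IH big_ord_recr /= nrC_sqrD -addrA; congr (_ + _).
rewrite nrCX y1 expr1n /dirichlet hornerD hornerC hornerZ ReD addrC.
congr (_ + _); first by rewrite expr1n.
have -> : (2 : C) = (2 : R)%:C by rewrite rmorph_nat.
rewrite [LHS]ReM /= mul0r subr0; congr (_ * _).
rewrite horner_sum; congr complex.Re.
rewrite rmorph_sum mulr_suml (reindex_inj rev_ord_inj) /=.
apply: eq_bigr => j _; rewrite hornerXn rmorphXn /=.
have -> : y ^+ N = y ^+ (j + (N - j)) by rewrite subnKC // ltnW.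
rewrite exprD mulrA -exprMn conj_mul_unit // expr1n mul1r.
by rewrite subnS prednK // subn_gt0.
Qed.

(** Here (y - 1) times the geometric sum is y^N - 1, of modulus at most 2. *)
Lemma fejer_far N (y : C) (d : R) : nr y = 1 -> 0 < d -> d <= nr (y - 1) ->
  complex.Re (fejer N).[y] <= 4 / d ^+ 2.
Proof.
move=> y1 d0 hd; rewrite fejer_sqr // ler_pdivlMr ?exprn_gt0 // -exprMn.
have -> : (4 : R) = 2 ^+ 2 by rewrite -natrX.
rewrite ler_pXn2r ?nnegrE ?mulr_ge0 ?nr_ge0 ?(ltW d0) //.
apply: (@le_trans _ _ (nr (\sum_(j < N) y ^+ j) * nr (y - 1))).
  by rewrite ler_wpM2l ?nr_ge0.
rewrite -nrCM mulrC -subrX1 (le_trans (nrD _ _)) // nrN nrC1 nrCX y1 expr1n.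
lra.
Qed.

Lemma fejer0 N : (fejer N).[0] = N%:R.
Proof.
elim: N => [|N IH]; first by rewrite /fejer big_ord0 horner0.
rewrite /fejer big_ord_recr /= hornerD IH -natr1; congr (_ + _).
rewrite /dirichlet hornerD hornerC hornerZ horner_sum big1 ?mulr0 ?addr0 // => j _.
by rewrite hornerXn expr0n.
Qed.

(** The N-th roots of unity. With them the Fejer kernel gives an exact
    partition of unity ([fejer_partition]), so that no integral is needed to
    approximate a function on the circle by real parts of polynomials. *)
Definition node (N k : nat) : C := expi (k%:R * (2 * pi / N%:R)).

Lemma nr_node N k : nr (node N k) = 1.
Proof. exact: nr_expi. Qed.

Lemma sum_nodes N j : (0 < j < N)%N -> \sum_(k < N) ((node N k)^*%C) ^+ j = 0.
Proof.
move=> /andP[j0 jN]; have N0 : (0 < N)%N by apply: leq_trans jN.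
have NR0 : (0 : R) < N%:R by rewrite ltr0n.
pose w := node N j.
have -> : \sum_(k < N) ((node N k)^*%C) ^+ j = (\sum_(k < N) w ^+ k)^*%C.
  rewrite rmorph_sum; apply: eq_bigr => k _; rewrite -rmorphXn; congr conjc.
  by rewrite /w /node !expiX; congr expi; ring.
have wN : w ^+ N = 1.
  rewrite /w /node expiX.
  have -> : N%:R * (j%:R * (2 * pi / N%:R)) = j%:R * (2 * pi) :> R by field; rewrite gt_eqF.
  rewrite -expiX; have -> : expi (2 * pi) = 1 :> C.
    by rewrite /expi mulr_natl cos2pi sin2pi.
  by rewrite expr1n.
have w1 : w - 1 != 0.
  rewrite subr_eq0; apply: expi_neq1; apply/andP; split.
    by rewrite !mulr_gt0 ?ltr0n ?invr_gt0 ?pi_gt0.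
  by rewrite mulrA ltr_pdivrMr // mulrC ltr_pM2l ?mulr_gt0 ?pi_gt0 // ltr_nat.
have : (w - 1) * \sum_(k < N) w ^+ k = 0 by rewrite -subrX1 wN subrr.
by move/eqP; rewrite mulf_eq0 (negPf w1) /= => /eqP ->; rewrite rmorph0.
Qed.

Lemma fejer_partition N (x : C) : (0 < N)%N ->
  \sum_(k < N) (fejer N).[x * (node N k)^*%C] = (N * N)%:R.
Proof.
move=> N0.
under eq_bigr do rewrite /fejer horner_sum.
rewrite exchange_big /=.
have -> : (N * N)%:R = \sum_(m < N) N%:R :> C by rewrite sumr_const card_ord natrM mulr_natr.
apply: eq_bigr => m _.
under eq_bigr do rewrite /dirichlet hornerD hornerC hornerZ horner_sum.
rewrite big_split /= sumr_const card_ord -[RHS]addr0; congr (_ + _).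
rewrite -mulr_sumr exchange_big /= big1 ?mulr0 // => j _.
under eq_bigr do rewrite hornerXn exprMn.
rewrite -mulr_sumr sum_nodes ?mulr0 //=.
exact: leq_ltn_trans (ltn_ord j) (ltn_ord m).
Qed.

(** The discretised Fejer mean of v. Its value at 0 is the average of v over
    the nodes. *)
Definition fejer_mean (N : nat) (v : C -> R) : {poly C} :=
  \sum_(k < N) (v (node N k) / (N * N)%:R)%:C *: (fejer N \Po ((node N k)^*%C *: 'X)).

Lemma Re_fejer_mean N v (x : C) : complex.Re (fejer_mean N v).[x] =
  \sum_(k < N) v (node N k) / (N * N)%:R * complex.Re (fejer N).[x * (node N k)^*%C].
Proof.
rewrite /fejer_mean horner_sum Re_sum; apply: eq_bigr => k _.
by rewrite hornerZ horner_comp hornerZ hornerX ReM /= mul0r subr0 [x * _]mulrC.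
Qed.

Lemma fejer_mean0 N v : (0 < N)%N ->
  complex.Re (fejer_mean N v).[0] = N%:R^-1 * \sum_(k < N) v (node N k).
Proof.
move=> N0; rewrite Re_fejer_mean mulr_sumr; apply: eq_bigr => k _.
rewrite mul0r fejer0 -[(N%:R : C)](rmorph_nat (real_complex R)) /= natrM.
by field; rewrite pnatr_eq0 -lt0n.
Qed.

(** The kernel is nonnegative with total mass one, and its mass outside
    |x - y| < d is O(1 / (d^2 N)). *)
Lemma fejer_approx N v (x : C) (B e d : R) : (0 < N)%N -> nr x = 1 -> 0 < d -> 0 <= e ->
  (forall y : C, nr y = 1 -> `|v y| <= B) ->
  (forall y : C, nr y = 1 -> nr (x - y) < d -> v x - e <= v y) ->
  v x - e - 8 * B / (d ^+ 2 * N%:R) <= complex.Re (fejer_mean N v).[x].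
Proof.
move=> N0 x1 d0 e0 hB hd; rewrite Re_fejer_mean.
have NR0 : (0 : R) < N%:R by rewrite ltr0n.
have B0 : 0 <= B by apply: le_trans (hB x x1).
pose F k := complex.Re (fejer N).[x * (node N k)^*%C].
have xn k : nr (x * (node N k)^*%C) = 1 by rewrite nrCM nrC_conj nr_node x1 mulr1.
have F0 k : 0 <= F k by rewrite /F fejer_sqr // sqr_ge0.
have NN0 : (0 : R) < (N * N)%:R by rewrite ltr0n muln_gt0 N0.
have sF : \sum_(k < N) F k / (N * N)%:R = 1.
  rewrite -mulr_suml -Re_sum fejer_partition //.
  by rewrite -(rmorph_nat (real_complex R)) /= divff // gt_eqF.
have -> : v x - e - 8 * B / (d ^+ 2 * N%:R) =
   \sum_(k < N) ((v x - e) * (F k / (N * N)%:R) - 8 * B / (d ^+ 2 * N%:R) / N%:R).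
  rewrite sumrB -mulr_sumr sF mulr1 sumr_const card_ord; congr (_ - _).
  by rewrite -[RHS]mulr_natr divfK // gt_eqF.
apply: ler_sum => k _; rewrite -/(F k).
have [hk|hk] := ltP (nr (x - node N k)) d.
  have h1 := hd _ (nr_node N k) hk.
  have h2 : 0 <= 8 * B / (d ^+ 2 * N%:R) / N%:R.
    by rewrite !divr_ge0 ?mulr_ge0 ?sqr_ge0 // ltW.
  have h3 : (v x - e) * (F k / (N * N)%:R) <= v (node N k) * (F k / (N * N)%:R).
    by rewrite ler_wpM2r // divr_ge0 // ltW.
  move: h3; rewrite [v (node N k) * _]mulrCA [F k / _ in X in _ -> X]mulrC; lra.
have hF : F k <= 4 / d ^+ 2.
  apply: fejer_far => //; apply: (le_trans hk).
  have -> : x * (node N k)^*%C - 1 = (x - node N k) * (node N k)^*%C.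
    by rewrite mulrBl [node N k * _]mulrC conj_mul_unit // nr_node.
  by rewrite nrCM nrC_conj nr_node mulr1.
have h1 : (v x - e - v (node N k)) <= 2 * B.
  have := hB _ x1; have := hB _ (nr_node N k); rewrite !ler_norml; lra.
have h2 : (v x - e - v (node N k)) * F k <= 2 * B * (4 / d ^+ 2).
  apply: (@le_trans _ _ (2 * B * F k)); first by rewrite ler_wpM2r.
  by rewrite ler_wpM2l // mulr_ge0.
have h3 : (v x - e - v (node N k)) * F k / (N * N)%:R <= 8 * B / (d ^+ 2 * N%:R) / N%:R.
  have -> : 8 * B / (d ^+ 2 * N%:R) / N%:R = 2 * B * (4 / d ^+ 2) / (N * N)%:R.
    by rewrite natrM; field; rewrite !gt_eqF.
  by rewrite ler_wpM2r // invr_ge0 ltW.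
have -> : v (node N k) / (N * N)%:R * F k =
  (v x - e) * (F k / (N * N)%:R) - (v x - e - v (node N k)) * F k / (N * N)%:R by ring.
lra.
Qed.

End Fejer.

(** * Integrals over the circle *)

Section CircleMean.
Variables (R : realType).
Local Notation C := R[i].
Local Notation mu := (@lebesgue_measure R).

Lemma MVT_lip (f df : R -> R) (s t : R) : (forall x : R, is_derive x (1 : R) f (df x)) ->
  (forall x : R, `|df x| <= 1) -> `|f t - f s| <= `|t - s|.
Proof.
move=> hf hd.
wlog st : s t / s <= t => [hw|].
  by have [/hw//|/ltW/hw] := leP s t; rewrite distrC [X in _ <= X]distrC.
have [|c _ ->] := MVT_segment st (fun x _ => hf x).
  apply: continuous_subspaceT => x; apply: differentiable_continuous.
  by apply/derivable1_diffP; case: (hf x).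
by rewrite normrM ler_piMl.
Qed.

Lemma expi_lip (s t : R) : nr (expi t - expi s) <= 2 * `|t - s|.
Proof.
apply: (le_trans (nrC_leD _)); rewrite mulr_natl mulr2n /= lerD //.
  apply: (@MVT_lip _ _ s t (@is_derive_cos R)) => x.
  by rewrite normrN ler_norml sin_geN1 sin_le1.
apply: (@MVT_lip _ _ s t (@is_derive_sin R)) => x.
by rewrite ler_norml cos_geN1 cos_le1.
Qed.

Lemma cont_expi (v : C -> R) : (forall x, nr x = 1 -> {for x, continuous v}) ->
  continuous (fun t : R => v (expi t)).
Proof.
move=> cv t; apply/cvgrPdist_lt => e e0.
have /cont_nrP/(_ e e0)[d d0 hd] := cv _ (nr_expi t).
have d20 : 0 < d / 2 by rewrite divr_gt0.
apply/nbhs_ballP; exists (d / 2) => //= s hs.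
rewrite distrC; apply: hd.
by apply: (le_lt_trans (expi_lip t s)); rewrite mulrC -ltr_pdivlMr // distrC.
Qed.

Lemma cont_integrable (f : R -> R) (a b : R) : continuous f ->
  mu.-integrable `[a, b] (EFin \o f).
Proof.
move=> cf; apply: continuous_compact_integrable; first exact: segment_compact.
by apply: continuous_subspaceT => x; exact: cf.
Qed.

Lemma cont_integrable_oc (f : R -> R) (a b : R) : continuous f ->
  mu.-integrable `]a, b] (EFin \o f).
Proof.
move=> cf; apply: (@integrableS _ _ _ mu `[a, b]) => //; last exact: cont_integrable.
by move=> t /=; rewrite !in_itv /= => /andP[/ltW -> ->].
Qed.

Lemma EFin_Rint (f : R -> R) (a b : R) : continuous f ->
  (\int[mu]_(t in `[a, b]) (f t)%:E)%E = (\int[mu]_(t in `[a, b]) f t)%:E.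
Proof.
move=> cf; rewrite /Rintegral fineK //; apply: integrable_fin_num => //.
exact: cont_integrable.
Qed.

Lemma Rint_lower (f : R -> R) (h c : R) N : continuous f -> 0 <= h ->
  (forall k t, k%:R * h <= t <= k.+1%:R * h -> f (k%:R * h) - c <= f t) ->
  h * \sum_(k < N) (f (k%:R * h) - c) <= \int[mu]_(t in `[0, N%:R * h]) f t.
Proof.
move=> cf h0 hf; elim: N => [|N IH].
  by rewrite big_ord0 mulr0 mul0r set_itv1 Rintegral_set1.
have e1 : \int[mu]_(t in `[0, N.+1%:R * h]) f t - \int[mu]_(t in `[0, N%:R * h]) f t =
   \int[mu]_(t in `]N%:R * h, N.+1%:R * h]) f t.
  apply: Rintegral_itvB; first exact: cont_integrable.
    by rewrite bnd_simp mulr_ge0.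
  by rewrite bnd_simp ler_wpM2r // ler_nat.
have e2 : \int[mu]_(t in `]N%:R * h, N.+1%:R * h]) (f (N%:R * h) - c) = h * (f (N%:R * h) - c).
  rewrite Rintegral_cst //= lebesgue_measure_itv /= lte_fin.
  case: ltP => hh.
    by rewrite -EFinB /= -natr1; ring.
  have -> : h = 0 by apply/eqP; rewrite eq_le h0 andbT; move: hh; rewrite -natr1; lra.
  by rewrite /= mulr0 mul0r.
have e3 : \int[mu]_(t in `]N%:R * h, N.+1%:R * h]) (f (N%:R * h) - c) <=
    \int[mu]_(t in `]N%:R * h, N.+1%:R * h]) f t.
  apply: le_Rintegral => //.
  - by apply: cont_integrable_oc => x; exact: cvg_cst.
  - exact: cont_integrable_oc.
  - by move=> t /=; rewrite in_itv /= => /andP[/ltW h1 h2]; apply: hf; rewrite h1.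
rewrite big_ord_recr /= mulrDr addrC.
rewrite -[leRHS](subrK (\int[mu]_(t in `[0, N%:R * h]) f t)).
by apply: lerD => //; rewrite e1 -e2.
Qed.

Lemma unif_cont (V : normedModType R[i]) (f : V -> R) (A : set V) (e : R) :
  compact A -> (forall x, A x -> {for x, continuous f}) -> 0 < e ->
  exists2 d : R, 0 < d & forall x y, A x -> nr (y - x) < d -> `|f y - f x| < e.
Proof.
move=> /compact_near_coveringP cA cf e0.
pose P (d : R) (x : V) := forall y, nr (y - x) < d -> `|f y - f x| < e.
have hP : \forall d \near 0^'+, A `<=` P d.
  apply: cA => x Ax.
  have e2 : 0 < e / 2 by rewrite divr_gt0.
  have /cont_nrP/(_ _ e2)[d d0 hd] := cf x Ax.
  have d20 : 0 < d / 2 by rewrite divr_gt0.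
  exists ([set w | nr (w - x) < d / 2], [set t | t < d / 2]) => /=.
    by split; [apply/nbhs_nrP; exists (d / 2)|exact: nbhs_right_lt].
  move=> [w t] /= [hw ht] y hy.
  have h1 : `|f w - f x| < e / 2 by apply: hd; lra.
  have h2 : `|f y - f x| < e / 2.
    apply: hd; rewrite -(subrK w y) -addrA; apply: (le_lt_trans (nrD _ _)); lra.
  rewrite (splitr e); have -> : f y - f w = (f y - f x) - (f w - f x) by ring.
  by apply: (le_lt_trans (ler_normB _ _)); rewrite ltrD.
have hP0 : \forall d \near (0 : R)^'+, 0 < d by exact: nbhs_right_gt.
have [d [d0 hd]] := filter_ex (filterI hP0 hP).
by exists d => // x y Ax hy; apply: hd.
Qed.

End CircleMean.

(** * Viscosity plurisubharmonicity and circle means *)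

Section Psh.
Variables (R : realType) (n : nat).
Local Notation C := R[i].
Local Notation T := 'rV[C]_n.
Local Notation mu := (@lebesgue_measure R).

(** Approximate the boundary values from above by the real part of a Fejer
    mean; by the maximum principle it majorises u at the centre, where it is
    the average over the nodes, that is, a Riemann sum of the integral. *)
Lemma vpsh_circle_mean (u : T -> R) (a b : T) :
  (forall x : C, nr x <= 1 -> {for a + x *: b, continuous u}) ->
  (forall x : C, nr x <= 1 -> vpsh u (a + x *: b)) ->
  2 * pi * u a <= \int[mu]_(t in `[0, 2 * pi]) u (a + expi t *: b).
Proof.
move=> cu vu; pose v (x : C) := u (a + x *: b).
have p0 : 0 < (pi : R) by exact: pi_gt0.
have cv x : nr x <= 1 -> {for x, continuous v} by move=> hx; apply: disc_cont; apply: cu.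
have cD := @cdisc_compact R 0 1.
have DE (x : C) : [set x | nr (x - 0) <= 1] x <-> nr x <= 1 by rewrite /= subr0.
have cvD x : [set x | nr (x - 0) <= 1] x -> {for x, continuous v}.
  by move=> /DE; apply: cv.
have D0 : [set x : C | nr (x - 0) <= 1] !=set0 by exists 0; apply/DE; rewrite nr0.
have [x1 _ hx1] := compact_max D0 cD cvD.
have cvND x : [set x | nr (x - 0) <= 1] x -> {for x, continuous (fun x => 0 - v x)}.
  by move=> /cvD cvx; apply: contB_at => //; exact: cst_continuous.
have [x2 _ hx2] := compact_max D0 cD cvND.
pose B := `|v x1| + `|v x2|.
have B0 : 0 <= B by rewrite addr_ge0.
have hB (y : C) : nr y = 1 -> `|v y| <= B.
  move=> y1; have /DE hy : nr y <= 1 by rewrite y1.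
  have := hx1 y hy; have := hx2 y hy; rewrite /B ler_norml.
  have := ler_norm (v x1); have := ler_norm (- v x2); rewrite normrN.
  have := normr_ge0 (v x1); have := normr_ge0 (v x2).
  by move=> h1 h2 h3 h4 h5 h6; apply/andP; split; lra.
apply/ler_addgt0Pl => e' e'0; pose e := e' / (6 * pi).
have e0 : 0 < e by rewrite divr_gt0 // mulr_gt0.
have [d d0 hd] := unif_cont cD cvD e0.
(* N is so large that the Fejer error is at most e and that neighbouring nodes
   are closer than d. *)
pose N := (Num.truncn (8 * B / (d ^+ 2 * e) + 4 * pi / d)).+1.
have hN : 8 * B / (d ^+ 2 * e) + 4 * pi / d < N%:R.
  by rewrite -truncn_le_nat // addr_ge0 ?divr_ge0 ?mulr_ge0 ?sqr_ge0 // ltW.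
have NR0 : (0 : R) < N%:R by rewrite ltr0n.
have de0 : 0 < d ^+ 2 * e by rewrite mulr_gt0 // exprn_gt0.
have hN1 : 8 * B / (d ^+ 2 * N%:R) <= e.
  rewrite ler_pdivrMr ?mulr_gt0 ?exprn_gt0 //.
  have : 8 * B / (d ^+ 2 * e) <= N%:R.
    apply: le_trans (ltW hN); rewrite lerDl divr_ge0 ?mulr_ge0 //; exact: ltW.
  rewrite (ler_pdivrMr _ _ de0) => h.
  by apply: (le_trans h); rewrite [leRHS]mulrCA [leRHS]mulrA [leRHS]mulrC.
have hN2 : 2 * (2 * pi / N%:R) < d.
  have : 4 * pi / d < N%:R.
    by apply: le_lt_trans hN; rewrite lerDr divr_ge0 ?(ltW de0) // mulr_ge0.
  rewrite ltr_pdivrMr // mulrA ltr_pdivrMr //; lra.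
have NP : (0 < N)%N by [].
clearbody N.
have hmax : u a <= N%:R^-1 * \sum_(k < N) v (node R N k) + 2 * e.
  have := @vpsh_max_principle R n u a b (fejer_mean N v + (2 * e)%:C%:P) cu vu.
  rewrite !hornerD !hornerC !ReD fejer_mean0 //; apply=> x x1'.
  rewrite hornerD hornerC ReD /= -lerBlDr.
  have x1D : [set x | nr (x - 0) <= 1] x by apply/DE; rewrite x1'.
  apply: le_trans (fejer_approx (B := B) (e := e) (d := d) _ x1' d0 (ltW e0) hB _) => //.
    by rewrite -/(v x); lra.
  move=> y y1 xy; have := hd x y x1D; rewrite nrB => /(_ xy).
  by rewrite ltr_norml => /andP[h1 h2]; lra.
have h0 : (0 : R) <= 2 * pi / N%:R by apply/ltW/divr_gt0 => //; apply: mulr_gt0.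
have cvt : continuous (fun t : R => v (expi t)).
  by apply: cont_expi => x x1'; apply: cv; rewrite x1'.
have hloc (k : nat) (t : R) : k%:R * (2 * pi / N%:R) <= t <= k.+1%:R * (2 * pi / N%:R) ->
    v (expi (k%:R * (2 * pi / N%:R))) - e <= v (expi t).
  move=> /andP[kt tk].
  have h1 : [set x | nr (x - 0) <= 1] (expi (k%:R * (2 * pi / N%:R)) : C).
    by apply/DE; rewrite nr_expi.
  have h4 : nr (expi t - expi (k%:R * (2 * pi / N%:R)) : C) < d.
    apply: le_lt_trans hN2; apply: (le_trans (expi_lip _ _)).
    rewrite ler_wpM2l // ger0_norm ?subr_ge0 //.
    by move: tk; rewrite -natr1 mulrDl mul1r; lra.
  by have := hd _ (expi t) h1 h4; rewrite ltr_norml => /andP[h2 h3]; lra.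
have := Rint_lower N cvt h0 hloc.
have -> : N%:R * (2 * pi / N%:R) = 2 * pi :> R by field; rewrite gt_eqF.
rewrite -/(v _).
have -> : \sum_(k < N) (v (expi (k%:R * (2 * pi / N%:R))) - e) =
   \sum_(k < N) v (node R N k) - e * N%:R.
  by rewrite sumrB sumr_const card_ord mulr_natr.
move: hmax; set S := \sum_(k < N) _; move: (\int[_]_(_ in _) _) => I hmax hI.
have h2 : 2 * pi * u a <= 2 * pi * (N%:R^-1 * S + 2 * e) by rewrite ler_wpM2l // mulr_ge0 // ltW.
apply: (le_trans h2).
have -> : 2 * pi * (N%:R^-1 * S + 2 * e) = 2 * pi / N%:R * (S - e * N%:R) + e'.
  rewrite /e; move: (N%:R : R) NR0 => N' N'0.
  move: (pi : R) p0 => p' p'0.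
  by field; rewrite (gt_eqF p'0) (gt_eqF N'0).
by rewrite addrC lerD2l.
Qed.

Lemma vpsh_psh (Omega : set T) (u : T -> R) : open Omega ->
  (forall z, Omega z -> {for z, continuous u}) ->
  (forall z, Omega z -> vpsh u z) -> psh Omega (EFin \o u).
Proof.
move=> oO cu vu; split.
- by move=> z _; rewrite /= ltry.
- move=> z c Oz; rewrite /= lte_fin => uc.
  have uc0 : 0 < c - u z by rewrite subr_gt0.
  have /cont_nrP/(_ _ uc0)[d d0 hd] := cu z Oz.
  apply/nbhs_nrP; exists d => // w /hd; rewrite ltr_norml lte_fin => /andP[_ h] _.
  by move: h; lra.
- move=> a b hab.
  have hab' (x : C) : nr x <= 1 -> Omega (a + x *: b).
    by move=> hx; apply: hab; rewrite nrC_le1.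
  have := @vpsh_circle_mean u a b (fun x hx => cu _ (hab' x hx)) (fun x hx => vu _ (hab' x hx)).
  have ct : continuous (fun t : R => u (a + expi t *: b)).
    apply: (@cont_expi _ (fun x : C => u (a + x *: b))) => x x1.
    by apply: disc_cont; apply: cu; apply: hab'; rewrite x1.
  rewrite /= EFin_Rint // -EFinM lee_fin => h.
  by rewrite ler_pdivlMl // !mulr_gt0 // pi_gt0.
Qed.

(** Averaging over the four rotations by powers of i annihilates x and x^2. *)
Lemma rotation_sum (al be x : C) :
  complex.Re (al * (x * 1) + be * (x * 1) ^+ 2) +
  complex.Re (al * (x * 'i) + be * (x * 'i) ^+ 2) +
  (complex.Re (al * (x * - 1) + be * (x * - 1) ^+ 2) +
  complex.Re (al * (x * - 'i) + be * (x * - 'i) ^+ 2)) = 0 :> R.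
Proof.
have ii : 'i * 'i = -1 :> C by rewrite -expr2 sqr_i.
rewrite -!ReD -[RHS]/(complex.Re (0 : C)); congr complex.Re.
have -> : be * (x * 'i) ^+ 2 = be * x ^+ 2 * ('i * 'i) by ring.
have -> : be * (x * - 'i) ^+ 2 = be * x ^+ 2 * ('i * 'i) by ring.
by rewrite ii; ring.
Qed.

(** If u were touched from above on a disc of radius s, the sum of its means
    over the four rotated circles would be at most 4 u(z) - 4 eps s^2 by
    [rotation_sum]. *)
Lemma psh_vpsh (Omega : set T) (u : T -> R) : open Omega ->
  (forall z, Omega z -> {for z, continuous u}) -> psh Omega (EFin \o u) ->
  forall z, Omega z -> vpsh u z.
Proof.
move=> oO cu [_ _ mu_u] z Oz b al be eps r eps0 r0 ht.
have /open_nrP/(_ _ Oz)[e e0 he] := oO.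
have [s /andP[s0 sr] hs] := small_disc b e0 r0.
have p0 : 0 < (pi : R) by exact: pi_gt0.
have main (w : C) : nr w = 1 -> exists g : R -> R,
    [/\ continuous g, 2 * pi * u z <= \int[mu]_(t in `[0, 2 * pi]) g t
      & forall t, g t <= u z + complex.Re (al * (s%:C * expi t * w) +
         be * (s%:C * expi t * w) ^+ 2) - eps * s ^+ 2].
  move=> w1; pose g t := u (z + expi t *: ((s%:C * w) *: b)).
  have hab (x : C) : nr x <= 1 -> Omega (z + x *: ((s%:C * w) *: b)).
    move=> hx; apply: he; rewrite addrC addKr scalerA; apply: hs.
    by rewrite !nrCM w1 mulr1 nr_real gtr0_norm // ler_piMl // ltW.
  have cg : continuous g.
    apply: (@cont_expi _ (fun x : C => u (z + x *: ((s%:C * w) *: b)))) => x x1.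
    by apply: disc_cont; apply: cu; apply: hab; rewrite x1.
  have hab2 (x : C) : `|x| <= 1 -> Omega (z + x *: ((s%:C * w) *: b)).
    by rewrite nrC_le1; exact: hab.
  exists g; split => //.
    have := mu_u z ((s%:C * w) *: b) hab2; rewrite /= EFin_Rint // -EFinM lee_fin.
    by rewrite ler_pdivlMl // !mulr_gt0.
  move=> t; set x := s%:C * expi t; have hx : nr (x * w) = s.
    by rewrite !nrCM w1 nr_expi !mulr1 nr_real gtr0_norm.
  have := ht (x * w); rewrite hx => /(_ sr) h.
  apply: le_trans h; rewrite /g scalerA.
  by have -> : expi t * (s%:C * w) = x * w by rewrite /x; ring.
have n1 := @nrC1 R.
have ni := @nrC_i R.
have nN1 : nr (- 1 : C) = 1 by rewrite nrN.
have nNi : nr (- 'i : C) = 1 by rewrite nrN.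
have [g1 [c1 m1 b1]] := main _ n1; have [g2 [c2 m2 b2]] := main _ ni.
have [g3 [c3 m3 b3]] := main _ nN1; have [g4 [c4 m4 b4]] := main _ nNi.
have c12 : continuous (fun t => g1 t + g2 t) by move=> t; apply: cvgD; [exact: c1|exact: c2].
have c34 : continuous (fun t => g3 t + g4 t) by move=> t; apply: cvgD; [exact: c3|exact: c4].
have c14 : continuous (fun t => g1 t + g2 t + (g3 t + g4 t)).
  by move=> t; apply: cvgD; [exact: c12|exact: c34].
have hle : \int[mu]_(t in `[0, 2 * pi]) (g1 t + g2 t + (g3 t + g4 t)) <=
   \int[mu]_(t in `[0, 2 * pi]) (4 * u z - 4 * (eps * s ^+ 2)).
  apply: le_Rintegral => //; [exact: cont_integrable| |].
    by apply: cont_integrable => t; exact: cvg_cst.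
  move=> t _; have := rotation_sum al be (s%:C * expi t).
  move: (b1 t) (b2 t) (b3 t) (b4 t) => /=.
  move: (complex.Re _) (complex.Re _) (complex.Re _) (complex.Re _) (eps * s ^+ 2).
  by move=> r1 r2 r3 r4 E; lra.
rewrite Rintegral_cst //= lebesgue_measure_itv /= lte_fin mulr_gt0 //= subr0 in hle.
have ci (f : R -> R) : continuous f -> mu.-integrable `[0, 2 * pi] (EFin \o f).
  exact: cont_integrable.
rewrite (RintegralD _ (ci _ c12) (ci _ c34)) // in hle.
rewrite (RintegralD _ (ci _ c1) (ci _ c2)) // in hle.
rewrite (RintegralD _ (ci _ c3) (ci _ c4)) // in hle.
move: m1 m2 m3 m4 hle.
move: (\int[_]_(_ in _) g1 _) (\int[_]_(_ in _) g2 _)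
  (\int[_]_(_ in _) g3 _) (\int[_]_(_ in _) g4 _).
move=> I1 I2 I3 I4 m1 m2 m3 m4 hle.
have : 0 < eps * s ^+ 2 * (2 * pi) by rewrite !mulr_gt0 // exprn_gt0.
lra.
Qed.

End Psh.

(** * Holder charts *)

Section Charts.
Variables (R : realType).
Local Notation C := R[i].

Lemma sqnormE n (z : 'rV[C]_n) : sqnorm z = \sum_(j < n) nr (z 0 j) ^+ 2.
Proof. by apply: eq_bigr => j _; rewrite nrC_sqr. Qed.

Lemma sqnorm_ge0 n (z : 'rV[C]_n) : 0 <= sqnorm z.
Proof. by rewrite sqnormE sumr_ge0 // => j _; rewrite sqr_ge0. Qed.

Lemma sqnormN n (z : 'rV[C]_n) : sqnorm (- z) = sqnorm z.
Proof. by rewrite !sqnormE; apply: eq_bigr => j _; rewrite mxE nrN. Qed.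

Lemma sqnorm_le n (z : 'rV[C]_n) : sqnorm z <= n%:R * nr z ^+ 2.
Proof.
rewrite sqnormE mulr_natl -[n in _ *+ n]card_ord -sumr_const ler_sum // => j _.
by rewrite ler_pXn2r ?nnegrE ?nr_ge0 // nr_entry.
Qed.

Lemma sqnormD n (x y : 'rV[C]_n) : sqnorm (x + y) <= 2 * sqnorm x + 2 * sqnorm y.
Proof.
rewrite !sqnormE !mulr_sumr -big_split /= ler_sum // => j _; rewrite mxE.
have h : nr (x 0 j + y 0 j) ^+ 2 <= (nr (x 0 j) + nr (y 0 j)) ^+ 2.
  by rewrite ler_pXn2r ?nnegrE ?nr_ge0 ?addr_ge0 ?nr_ge0 // nrD.
apply: (le_trans h); rewrite sqrrD.
have := sqr_ge0 (nr (x 0 j) - nr (y 0 j)); rewrite sqrrB; lra.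
Qed.

Lemma nrC_sum (I : Type) (s : seq I) (F : I -> C) :
  nr (\sum_(i <- s) F i) <= \sum_(i <- s) nr (F i).
Proof.
elim: s => [|i s IH]; first by rewrite !big_nil nr0.
by rewrite !big_cons (le_trans (nrD _ _)) // lerD2l.
Qed.

Lemma mulmx_bound m n (A : 'M[C]_(m, n)) : exists2 L : R, 0 <= L &
  forall z, sqnorm (z *m A) <= (L * nr z) ^+ 2.
Proof.
pose L1 := \sum_(i < m) \sum_(j < n) nr (A i j).
have L10 : 0 <= L1 by rewrite sumr_ge0 // => i _; rewrite sumr_ge0 // => j _; exact: nr_ge0.
exists (n%:R * L1); first by rewrite mulr_ge0.
move=> z; apply: (le_trans (sqnorm_le _)).
have h : nr (z *m A) <= L1 * nr z.
  apply: nr_le => [|j]; first by rewrite mulr_ge0 // nr_ge0.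
  rewrite mxE; apply: (le_trans (nrC_sum _ _)); rewrite mulr_suml ler_sum // => i _.
  rewrite nrCM mulrC ler_pM ?nr_ge0 ?nr_entry //.
  by rewrite (bigD1 j) //= lerDl sumr_ge0 // => k _; exact: nr_ge0.
have L1z : 0 <= L1 * nr z by rewrite mulr_ge0 // nr_ge0.
have h2 : nr (z *m A) ^+ 2 <= (L1 * nr z) ^+ 2 by rewrite ler_pXn2r ?nnegrE ?nr_ge0.
case: n A L1 L10 h L1z h2 => [|n] A L1 L10 h L1z h2; first by rewrite !mul0r expr0n.
rewrite -mulrA exprMn [X in _ <= X * _]expr2 -mulrA.
have n1 : (1 : R) <= n.+1%:R by rewrite ler1n.
apply: ler_pM => //; first by rewrite sqr_ge0.
by rewrite (le_trans h2) // ler_peMl // sqr_ge0.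
Qed.

Lemma graph_sqnormE m (z : 'rV[C]_m.+1) :
  graph_sqnorm (graph_coord z) + complex.Im (z 0 ord_max) ^+ 2 = sqnorm z.
Proof.
rewrite /graph_sqnorm /graph_coord /= /sqnorm big_ord_recr /= addrA; congr (_ + _ + _).
apply: eq_bigr => j _; rewrite !mxE.
have -> // : lift ord_max j = widen_ord (leqnSn m) j.
by apply/val_inj; rewrite /= /bump leqNgt ltn_ord.
Qed.

Lemma graph_coordB m (x y : 'rV[C]_m.+1) :
  graph_coord x - graph_coord y = graph_coord (x - y).
Proof.
rewrite /graph_coord; congr pair; first by apply/rowP => j; rewrite !mxE.
by rewrite !mxE /=; rewrite ReD ReN.
Qed.

Lemma holder_scale (K beta : R) : 0 < beta -> exists2 t : R, 0 < t <= 2^-1 &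
  K * t `^ beta <= 2^-1.
Proof.
move=> b0; pose s := (2 * (`|K| + 1))^-1.
have K1 : 0 < `|K| + 1 by rewrite ltr_wpDl.
have s0 : 0 < s by rewrite invr_gt0 mulr_gt0.
exists (Num.min 2^-1 (s `^ beta^-1)).
  by rewrite lt_min invr_gt0 ltr0n powR_gt0 //= ge_min lexx.
apply: (@le_trans _ _ ((`|K| + 1) * s)); last first.
  by rewrite le_eqVlt; apply/orP; left; apply/eqP; rewrite /s; field; rewrite gt_eqF.
apply: (@le_trans _ _ (`|K| * Num.min 2^-1 (s `^ beta^-1) `^ beta)).
  by rewrite ler_wpM2r ?powR_ge0 // ler_norm.
apply: ler_pM; rewrite ?powR_ge0 ?lerDl //.
apply: (@le_trans _ _ ((s `^ beta^-1) `^ beta)).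
  by apply: ge0_ler_powR; rewrite ?nnegrE ?ge_min ?lexx ?orbT ?le_min ?powR_ge0 ?invr_ge0 // ltW.
by rewrite -powRrM mulVf ?gt_eqF // powRr1 // ltW.
Qed.

Lemma powR_small (e beta : R) N : 0 < e <= 1 -> 1 <= N%:R * beta -> (e ^+ N) `^ beta <= e.
Proof.
move=> /andP[e0 e1] Nb.
rewrite -powR_mulrn ?(ltW e0) // -powRrM ge1r_powR ?e0 //.
Qed.

(** Let v be the direction in which Im z_n increases at unit speed in the
    coordinates of the chart. Lowering a point of Omega by e leaves a gap e
    below the graph. A displacement of size t in these coordinates changes
    the graph by at most |K| t^beta and the height by at most t; for
    t <= t0 e^N with N beta >= 1 this is less than e, so the point is still at
    distance of order e^N from the complement. *)
Lemma holder_chart m (Omega : set 'rV[C]_m.+1) (M : R) (a : 'rV[C]_m.+1) :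
  open Omega -> (forall z, Omega z -> nr z <= M) -> holder_boundary Omega ->
  boundary Omega a ->
  exists (rho : R) (v : 'rV[C]_m.+1) (N : nat) (c e0 : R),
   [/\ 0 < rho, (0 < N)%N, 0 < c, 0 < e0 <= 1 &
   forall z, Omega z -> nr (z - a) < rho -> forall e, 0 < e <= e0 ->
     c * e ^+ N <= bdist Omega (z - e%:C *: v)].
Proof.
move=> oO bO hO ba; have [A [r [beta [g [uA r0 /andP[b0 b1] [K hK] hA]]]]] := hO a ba.
have [L L0 hL] := mulmx_bound A.
have L1 : 0 < L + 1 by rewrite ltr_wpDl.
have [t0 /andP[t00 t01] ht0] := holder_scale `|K| b0.
pose N := (Num.truncn beta^-1).+1.
have hN : beta^-1 <= N%:R by apply/ltW; rewrite -truncn_le_nat // invr_ge0 ltW.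
have hNb : 1 <= N%:R * beta by rewrite -ler_pdivrMr // div1r.
pose dn : 'rV[C]_m.+1 := 'i *: delta_mx 0 ord_max.
pose v := dn *m invmx A.
exists (r / (4 * (L + 1))), v, N, (t0 / (L + 1)), (Num.min 1 (r / 4)).
split => //.
- by rewrite divr_gt0 // mulr_gt0.
- by rewrite divr_gt0.
- by rewrite lt_min ltr01 divr_gt0 //= ge_min lexx.
move=> z Oz za e /andP[e0]; rewrite le_min => /andP[e1 er].
apply: (le_bdist bO) => q Oq; rewrite leNgt; apply/negP => hq; apply: Oq.
pose w := (z - a) *m A; pose xi := (q - (z - e%:C *: v)) *m A.
have hw : sqnorm w <= (r / 4) ^+ 2.
  apply: (le_trans (hL _)); rewrite ler_pXn2r ?nnegrE ?mulr_ge0 ?nr_ge0 //; last first.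
    by rewrite ltW // divr_gt0.
  have h : nr (z - a) * (4 * (L + 1)) < r by rewrite -ltr_pdivlMr // mulr_gt0.
  have := nr_ge0 (z - a); nra.
have e01 : 0 <= e ^+ N <= e.
  by rewrite exprn_ge0 ?(ltW e0) //= exprS ler_piMr ?exprn_ile1 // ltW.
have /andP[eN0 eN1] := e01.
pose s := Num.sqrt (sqnorm xi).
have s0 : 0 <= s by rewrite sqrtr_ge0.
have hs : s <= t0 * e ^+ N.
  rewrite -(@ler_pXn2r _ 2) ?nnegrE ?mulr_ge0 ?(ltW t00) // sqr_sqrtr ?sqnorm_ge0 //.
  apply: (le_trans (hL _)).
  rewrite ler_pXn2r ?nnegrE ?mulr_ge0 ?nr_ge0 ?(ltW t00) //.
  have : nr (q - (z - e%:C *: v)) * (L + 1) < t0 * e ^+ N.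
    by rewrite -ltr_pdivlMr // mulrAC.
  have := nr_ge0 (q - (z - e%:C *: v)); lra.
have wq : (q - a) *m A = w + (xi - e%:C *: dn).
  have hv : e%:C *: dn = (e%:C *: v) *m A by rewrite -scalemxAl /v mulmxKV.
  by rewrite /w /xi hv -mulmxBl -mulmxDl; congr (_ *m _); apply/rowP => i; rewrite !mxE; ring.
have dnE j : dn 0 j = if j == ord_max then 'i else 0.
  by rewrite /dn !mxE eqxx /=; case: eqP => _; rewrite ?mulr1 ?mulr0.
have hdn : sqnorm (- (e%:C *: dn)) = e ^+ 2.
  rewrite sqnormE (bigD1 ord_max) //= big1 => [|j jm].
    by rewrite addr0 mxE mxE dnE eqxx nrN nrCM nrC_i mulr1 nr_real gtr0_norm.
  by rewrite mxE mxE dnE (negPf jm) mulr0 nrN nr0 expr0n.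
have hE : eball r ((q - a) *m A).
  rewrite /eball /= wq; apply: (le_lt_trans (sqnormD _ _)).
  have := sqnormD xi (- (e%:C *: dn)); rewrite hdn.
  have : sqnorm xi <= e ^+ 2.
    rewrite -[sqnorm xi]sqr_sqrtr ?sqnorm_ge0 // ler_pXn2r ?nnegrE ?(ltW e0) //.
    by apply: (le_trans hs); nra.
  have : e ^+ 2 <= (r / 4) ^+ 2 by rewrite ler_pXn2r ?nnegrE ?(ltW e0) // ltW // divr_gt0.
  have : 0 < r ^+ 2 by rewrite exprn_gt0.
  move: hw; rewrite /s; rewrite !exprMn; lra.
have hEw : eball r w.
  rewrite /eball /=; apply: (le_lt_trans hw).
  by rewrite ltr_pXn2r ?nnegrE ?(ltW r0) ?divr_ge0 ?(ltW r0) //; lra.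
have /= [_ hImw] : [set w | eball r w /\ complex.Im (w 0 ord_max) < g (graph_coord w)] w.
  by rewrite -hA; split => //; exists z.
have gball (y : 'rV[C]_m.+1) : eball r y -> graph_ball r (graph_coord y).
  rewrite /eball /graph_ball /= => h; apply: le_lt_trans h.
  by rewrite -graph_sqnormE lerDl sqr_ge0.
have hg := hK _ _ (gball _ hEw) (gball _ hE).
have gxi : graph_sqnorm (graph_coord w - graph_coord ((q - a) *m A)) <= sqnorm xi.
  rewrite graph_coordB wq.
  have -> : graph_coord (w - (w + (xi - e%:C *: dn))) = graph_coord (- xi).
    have -> : w - (w + (xi - e%:C *: dn)) = - xi + e%:C *: dn.
      by rewrite opprD addrA subrr add0r opprB addrC.
    have ent j : (- xi + e%:C *: dn) 0 j = (- xi) 0 j + e%:C * (if j == ord_max then 'i else 0).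
      rewrite [LHS]mxE; congr (_ + _); by rewrite mxE dnE.
    rewrite /graph_coord; congr pair.
      apply/rowP => j; rewrite [LHS]mxE [RHS]mxE ent.
      by rewrite eq_sym (negPf (neq_lift ord_max j)) mulr0 addr0.
    by rewrite ent eqxx ReD ReM /= mulr0 mul0r subrr addr0.
  rewrite -(sqnormN xi).
  by rewrite -graph_sqnormE lerDl sqr_ge0.
have hg2 : `|g (graph_coord w) - g (graph_coord ((q - a) *m A))| <= e / 2.
  apply: (le_trans hg); apply: (@le_trans _ _ (`|K| * Num.sqrt (graph_sqnorm
      (graph_coord w - graph_coord ((q - a) *m A))) `^ beta)).
    by rewrite ler_wpM2r ?powR_ge0 // ler_norm.
  apply: (@le_trans _ _ (`|K| * (t0 `^ beta * e))); last first.
    by rewrite mulrA [leRHS]mulrC ler_wpM2r // ltW.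
  rewrite ler_wpM2l //; apply: (@le_trans _ _ ((t0 * e ^+ N) `^ beta)).
    apply: ge0_ler_powR; rewrite ?nnegrE ?sqrtr_ge0 ?mulr_ge0 ?(ltW b0) ?(ltW t00) //.
    by apply: le_trans hs; rewrite ler_sqrt // sqnorm_ge0.
  rewrite powRM ?(ltW t00) // ler_wpM2l ?powR_ge0 // powR_small // e0 e1 //.
have hIm : complex.Im (((q - a) *m A) 0 ord_max) <= complex.Im (w 0 ord_max) - e + t0 * e ^+ N.
  rewrite wq mxE ImD -addrA lerD2l mxE ImD addrC.
  have -> : complex.Im ((- (e%:C *: dn)) 0 ord_max) = - e.
    by rewrite mxE mxE dnE eqxx ImN ImM /= mulr1 mul0r addr0.
  rewrite lerD2r (le_trans (ler_norm _)) // (le_trans (nrC_Im _)) //.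
  apply: le_trans hs; rewrite -(@ler_pXn2r _ 2) ?nnegrE ?nr_ge0 //.
  rewrite sqr_sqrtr ?sqnorm_ge0 // sqnormE (bigD1 ord_max) //= lerDl sumr_ge0 // => j _.
  exact: sqr_ge0.
have hin : [set y | eball r y /\ complex.Im (y 0 ord_max) < g (graph_coord y)] ((q - a) *m A).
  split => //; move: hg2; rewrite ler_norml => /andP[_ h1].
  have : t0 * e ^+ N <= 2^-1 * e by apply: ler_pM => //; exact: ltW.
  lra.
move: hin; rewrite -hA => -[[q' Oq' qq'] _].
have := congr1 (fun y => y *m invmx A + a) qq'; rewrite !mulmxK // !subrK => <-.
exact: Oq'.
Qed.

End Charts.

(** * A finite atlas near the boundary *)

Section Cover.
Variables (R : realType) (m : nat).
Local Notation C := R[i].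
Local Notation T := 'rV[C]_m.+1.

Lemma nr_sqnorm (z : T) : nr z ^+ 2 <= sqnorm z.
Proof.
rewrite -[leRHS]sqr_sqrtr ?sqnorm_ge0 // ler_pXn2r ?nnegrE ?nr_ge0 ?sqrtr_ge0 //.
apply: nr_le => [|i]; first exact: sqrtr_ge0.
rewrite -(@ler_pXn2r _ 2) ?nnegrE ?nr_ge0 ?sqrtr_ge0 // sqr_sqrtr ?sqnorm_ge0 //.
by rewrite sqnormE (bigD1 i) //= lerDl sumr_ge0 // => j _; exact: sqr_ge0.
Qed.

Lemma sqnorm_line (z b : T) : exists ga : C, forall x : C,
  sqnorm (z + x *: b) = sqnorm z + complex.Re (ga * x) + sqnorm b * nr x ^+ 2.
Proof.
exists (2 * \sum_(j < m.+1) (z 0 j)^*%C * b 0 j) => x.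
rewrite !sqnormE mulr_suml -mulrA mulr_suml mulr_sumr Re_sum -!big_split /=.
apply: eq_bigr => j _; rewrite !mxE nrC_sqrD nrCM.
have -> : (2 : C) = (2 : R)%:C by rewrite rmorph_nat.
rewrite [complex.Re (_%:C * _)]ReM /= mul0r subr0 -[_ * b 0 j * x]mulrA [b 0 j * x]mulrC.
by ring.
Qed.

Lemma sqnorm_cont (a : T) : continuous (fun z : T => sqnorm (z - a)).
Proof.
move=> z; apply/cont_nrP => e e0.
pose n : R := m.+1%:R.
have n0 : 0 < n by rewrite ltr0n.
pose S := 2 * n * nr (z - a) + n.
have S0 : 0 < S + 1.
  have : 0 <= 2 * n * nr (z - a) by rewrite !mulr_ge0 ?nr_ge0 // ltW.
  by rewrite /S; lra.
exists (Num.min 1 (e / (S + 1))); first by rewrite lt_min ltr01 divr_gt0.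
move=> w; rewrite lt_min => /andP[h1]; rewrite ltr_pdivlMr // => he.
have h0 := nr_ge0 (w - z).
have -> : w - a = (z - a) + (w - z) by rewrite [RHS]addrC addrA subrK.
rewrite !sqnormE -sumrB; apply: (le_lt_trans (ler_norm_sum _ _ _)).
apply: (@le_lt_trans _ _ (\sum_(i < m.+1) (2 * nr (z - a) + 1) * nr (w - z))).
  apply: ler_sum => i _; rewrite mxE nrC_sqrD.
  move: (nr_entry (z - a) i) (nr_entry (w - z) i) (nr_ge0 ((z - a) 0 i)) (nr_ge0 ((w - z) 0 i)).
  move: ((z - a) 0 i) ((w - z) 0 i) => p q hp hq p0 q0.
  have hr : `|complex.Re (p^*%C * q)| <= nr (z - a) * nr (w - z).
    by rewrite (le_trans (nrC_Re _)) // nrCM nrC_conj ler_pM.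
  have hq2 : nr q ^+ 2 <= nr (w - z) by nra.
  move: hr; rewrite ler_norml => /andP[h2 h3].
  rewrite ler_norml; have := sqr_ge0 (nr q); move: (complex.Re _) h2 h3 => X h2 h3 h4.
  by apply/andP; split; lra.
rewrite sumr_const card_ord -mulr_natr -/n.
apply: le_lt_trans he; rewrite /S; nra.
Qed.

(** The inverse of 1 + sum of the 1 / f i is a common lower bound. *)
Lemma inv_sum_le (I : finType) (f : I -> R) : (forall i, 0 < f i) ->
  exists2 c : R, 0 < c <= 1 & forall i, c <= f i.
Proof.
move=> f0; pose S := \sum_i (f i)^-1.
have S0 : 0 <= S by rewrite sumr_ge0 // => i _; rewrite invr_ge0 ltW.
have S1 : 0 < 1 + S by rewrite ltr_pwDl.
exists (1 + S)^-1; first by rewrite invr_gt0 S1 invf_le1 // lerDl.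
move=> i; rewrite -[leRHS]invrK lef_pV2 ?posrE ?invr_gt0 //.
rewrite /S (bigD1 i) //= addrCA lerDl addr_ge0 // sumr_ge0 // => j _.
by rewrite invr_ge0 ltW.
Qed.

Variables (Omega : set T) (M : R).
Hypothesis oO : open Omega.
Hypothesis bO : forall z, Omega z -> nr z <= M.
Hypothesis hO : holder_boundary Omega.

Lemma closure_bounded z : closure Omega z -> nr z <= M + 1.
Proof.
move=> /closure_nrP/(_ _ ltr01)[w Ow hw].
by rewrite -[z](subrKC w) (le_trans (nrD _ _)) // lerD ?bO // nrB ltW.
Qed.

Lemma boundary_compact : compact (boundary Omega).
Proof.
apply: (@closed_bounded_compact _ _ _ (M + 1)).
  rewrite /boundary setDE; apply: closedI; first exact: closed_closure.
  by apply: open_closedC; exact: open_interior.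
by move=> z [/closure_bounded].
Qed.

(** Finitely many half balls around boundary points cover the boundary, and
    what they leave of the closure of Omega is a compact subset of Omega, on
    which the distance to the complement is bounded below. *)
Lemma finite_charts : exists (I : finType) (a v : I -> T) (rho : I -> R) (N : nat) (c e0 dl0 : R),
  [/\ (0 < N)%N, 0 < c, 0 < e0 <= 1, 0 < dl0 & forall i, 0 < rho i] /\
  (forall i z, Omega z -> sqnorm (z - a i) < rho i ^+ 2 -> forall e, 0 < e <= e0 ->
     c * e ^+ N <= bdist Omega (z - e%:C *: v i)) /\
  (forall z, Omega z -> bdist Omega z < dl0 -> exists i, sqnorm (z - a i) < (rho i / 2) ^+ 2).
Proof.
pose P (a : T) (p : R * T * nat * R * R) :=
   [/\ 0 < p.1.1.1.1, (0 < p.1.1.2)%N, 0 < p.1.2, 0 < p.2 <= 1 &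
   forall z, Omega z -> nr (z - a) < p.1.1.1.1 -> forall e, 0 < e <= p.2 ->
     p.1.2 * e ^+ p.1.1.2 <= bdist Omega (z - e%:C *: p.1.1.1.2)].
have /boolp.choice[F hF] : forall a : T, exists p, boundary Omega a -> P a p.
  move=> a; have [ba|nba] := pselect (boundary Omega a); last first.
    by exists (0, 0, 0%N, 0, 0) => /nba.
  by have [rho [v [N [c [e0 h]]]]] := holder_chart oO bO hO ba; exists (rho, v, N, c, e0).
pose ro a := (F a).1.1.1.1.
have ro0 a : boundary Omega a -> 0 < ro a by move=> /hF[].
pose B (a : T) := [set z : T | sqnorm (z - a) < (ro a / 2) ^+ 2].
have oB a : open (B a).
  have /continuousP/(_ _ (@open_lt R ((ro a / 2) ^+ 2))) := @sqnorm_cont a.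
  by [].
have := boundary_compact; rewrite compact_cover.
move=> /(_ T (boundary Omega) B (fun a _ => oB a)) [].
  move=> a ba; exists a => //; rewrite /B /= subrr sqnormE big1 ?exprn_gt0 ?divr_gt0 ?ro0 //.
  by move=> i _; rewrite mxE nr0 expr0n.
move=> D hD hcov.
pose I : finType := finmap.fset_sub_type D.
have bD (i : I) : boundary Omega (val i) by apply/set_mem/hD; exact: finmap.fsvalP.
have hP (i : I) : P (val i) (F (val i)) := hF _ (bD i).
have [c /andP[c0 _] hc] := @inv_sum_le I (fun i => (F (val i)).1.2)
  (fun i => let: And5 _ _ h _ _ := hP i in h).
have [e0 e01 he0] := @inv_sum_le I (fun i => (F (val i)).2)
   (fun i => let: And5 _ _ _ h _ := hP i in proj1 (andP h)).
pose N := (\max_(i : I) (F (val i)).1.1.2).+1.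
pose U := \bigcup_(i in [set` D]) B i.
have oU : open U by apply: bigcup_open.
pose K := closure Omega `&` ~` U.
have KO z : K z -> Omega z.
  move=> [cz nUz]; apply: contrapT => nO; apply: nUz; apply: hcov; split => //.
  by move=> /interior_subset.
have cK : compact K.
  apply: (@closed_bounded_compact _ _ _ (M + 1)); last by move=> z [/closure_bounded].
  by apply: closedI; [exact: closed_closure|exact: open_closedC].
have [dl0 dl00 hdl0] : exists2 dl0 : R, 0 < dl0 & forall z, K z -> dl0 <= bdist Omega z.
  have [K0|K0] := pselect (K !=set0); last by exists 1 => // z Kz; case: K0; exists z.
  have [|z Kz hz] := compact_max (f := fun z => - bdist Omega z) K0 cK.
    by move=> x _; apply: continuousN; exact: (bdist_cont bO).
  exists (bdist Omega z); first by apply/(bdist_gt0 oO bO)/KO.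
  by move=> w /hz; rewrite lerN2.
exists I, val, (fun i => (F (val i)).1.1.1.2), (fun i => ro (val i)), N, c, e0, dl0.
split; [|split].
- by split => // i; apply: ro0.
- move=> i z Oz hz e /andP[e_0 ee0].
  have [_ _ ci0 /andP[_ ei1] h] := hP i.
  have ei : e <= (F (val i)).2 by apply: le_trans ee0 (he0 i).
  have hzi : nr (z - val i) < ro (val i).
    rewrite -(@ltr_pXn2r _ 2) ?nnegrE ?nr_ge0 ?(ltW (ro0 _ (bD i))) //.
    exact: le_lt_trans (nr_sqnorm _) hz.
  apply: le_trans (h z Oz hzi e _); last by rewrite e_0.
  apply: ler_pM; rewrite ?exprn_ge0 ?(ltW e_0) ?(ltW c0) ?hc //.
  apply: ler_wiXn2l; rewrite ?(ltW e_0) ?(le_trans ei) //.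
  by rewrite leqW // (bigD1 i) //= leq_maxl.
- move=> z Oz dz; have : U z.
    apply: contrapT => nUz; have := hdl0 z; rewrite leNgt dz => h.
    by have : false by apply: h; split => //; exact: subset_closure.
  by move=> [i /= iD hi]; exists (finmap.FSetSub iD).
Qed.

End Cover.

(** * Barriers in a chart *)

Section LocalBarriers.
Variables (R : realType) (m : nat).
Local Notation C := R[i].
Local Notation T := 'rV[C]_m.+1.
Variables (Omega : set T) (M : R).
Hypothesis oO : open Omega.
Hypothesis bO : forall z, Omega z -> nr z <= M.
Local Notation d := (bdist Omega).
Hypothesis oka : forall z, Omega z -> vpsh (fun w => - ln (d w)) z.
Variables (I : finType) (a v : I -> T) (rho : I -> R) (N : nat) (c e0 : R).
Hypotheses (N0 : (0 < N)%N) (c0 : 0 < c) (e01 : 0 < e0 <= 1).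
Hypothesis chart : forall i z, Omega z -> sqnorm (z - a i) < rho i ^+ 2 ->
  forall e, 0 < e <= e0 -> c * e ^+ N <= d (z - e%:C *: v i).

Variable V : R.
Hypotheses (V1 : 1 <= V) (v_le : forall i, nr (v i) <= V).

Lemma shift_bounds : exists2 B : R, 0 <= B & forall i z, Omega z ->
  sqnorm (z - a i) < rho i ^+ 2 -> forall e, 0 < e <= e0 ->
  [/\ 0 < d (z - e%:C *: v i),
      - B + N%:R * ln e <= ln (d (z - e%:C *: v i)) <= B,
      d z <= e -> ln (d (z - e%:C *: v i)) <= ln e + B
    & forall dl, 0 < dl -> dl <= d z -> e * V <= dl / 2 ->
      ln (dl / 2) <= ln (d (z - e%:C *: v i))].
Proof.
have [p0 hp0] := unbounded_point bO.
pose D := nr p0 + `|M| + V.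
have D1 : 1 <= D by apply: (le_trans V1); rewrite /D lerDr addr_ge0 ?nr_ge0.
have V0 : 0 < V := lt_le_trans ltr01 V1.
exists (`|ln c| + ln D + ln (1 + V)).
  by rewrite !addr_ge0 // ln_ge0 //; lra.
have lD : 0 <= ln D by rewrite ln_ge0.
have lV : 0 <= ln (1 + V) by rewrite ln_ge0; lra.
move=> i z Oz hz e /andP[e_0 ee0]; set w := z - e%:C *: v i.
have hc := chart Oz hz (e := e).
have {}hc : c * e ^+ N <= d w by apply: hc; rewrite e_0.
have ceN : 0 < c * e ^+ N by rewrite mulr_gt0 // exprn_gt0.
have dw0 : 0 < d w by apply: lt_le_trans hc.
have e1 : e <= 1 by case/andP: e01 => _; exact: le_trans.
have hev : nr (e%:C *: v i) <= e * V.
  by rewrite nrZ nr_real gtr0_norm // ler_wpM2l // ltW.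
have heV : e * V <= V by rewrite ler_piMl // ltW.
have wz : nr (w - z) <= e * V by rewrite /w addrC addKr nrN.
have cc := ler_norm (- ln c); rewrite normrN in cc.
split => //.
- apply/andP; split.
    have : ln (c * e ^+ N) <= ln (d w) by rewrite ler_ln.
    rewrite lnM ?posrE ?exprn_gt0 // lnXn // -mulr_natl; lra.
  have : ln (d w) <= ln D.
    rewrite ler_ln ?posrE //; last by lra.
    apply: (le_trans (bdist_le bO w hp0)); apply: (le_trans (nrD _ _)); rewrite nrN.
    rewrite /D -addrA lerD2l -[w](subrK z) addrC (le_trans (nrD _ _)) // lerD //.
      exact: le_trans wz heV.
    exact: le_trans (bO Oz) (ler_norm _).
  have := normr_ge0 (ln c); lra.
- move=> dze; have : ln (d w) <= ln (e * (1 + V)).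
    rewrite ler_ln ?posrE ?mulr_gt0 //; last by lra.
    have := bdist_lip bO w z; rewrite nrB; nra.
  rewrite lnM ?posrE //; last by lra.
  have := normr_ge0 (ln c); lra.
- move=> dl dl_0 dldz heV2; rewrite ler_ln ?posrE ?divr_gt0 //.
  have := bdist_lip bO z w; lra.
Qed.

Lemma ln_large (X : R) : exists2 e : R, 0 < e & forall t, 0 < t <= e -> X <= - ln t.
Proof.
exists (expR (- X)); first exact: expR_gt0.
move=> t /andP[t0 te]; rewrite lerNr -[leRHS]expRK ler_ln ?posrE //.
exact: expR_gt0.
Qed.

(** The barriers are s = 1 + tau + (B + ln d(z - e v_i)) / (N ln (1/e)) with
    tau = 1 / (4N). The Holder bound d(z - e v_i) >= c e^N keeps them
    above tau; where d <= e, the shifted distance is O(e) and s is at most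
    about 1 + tau - 1/N; where d >= dl k / 2 the quotient tends to 0 with e.
    All charts use the same e, chosen as dl (k+1) once dl k is known. *)
Lemma local_barriers (dl0 : R) : 0 < dl0 ->
  exists (s : nat -> I -> T -> R) (dl : nat -> R) (tau gam : R),
  [/\ 0 < tau <= 1, 0 < gam < 1, dl 0%N = dl0 &
   forall k, 0 < dl k.+1 <= dl k / 2 /\ forall i z, Omega z -> sqnorm (z - a i) < rho i ^+ 2 ->
   [/\ tau <= s k i z <= 2, d z <= dl k.+1 -> s k i z <= gam, dl k / 2 <= d z -> 1 <= s k i z,
    {for z, continuous (s k i)} & vpsh (fun w => - s k i w) z]].
Proof.
move=> dl00; have [B B0 hB] := shift_bounds.
have NR0 : (0 : R) < N%:R by rewrite ltr0n.
pose tau : R := (4 * N%:R)^-1.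
have tau0 : 0 < tau by rewrite invr_gt0 mulr_gt0.
have N1 : (1 : R) <= N%:R by rewrite ler1n.
have tau4 : tau <= 4^-1 by rewrite lef_pV2 ?posrE ?mulr_gt0 //; lra.
have tN : tau * N%:R = 4^-1 by rewrite /tau; field; rewrite gt_eqF.
pose s (e : R) i z := 1 + tau + (B + ln (d (z - e%:C *: v i))) / (N%:R * - ln e).
have step (dl : R) : exists e : R, 0 < dl -> 0 < e <= dl / 2 /\
   forall i z, Omega z -> sqnorm (z - a i) < rho i ^+ 2 ->
   [/\ tau <= s e i z <= 2, d z <= e -> s e i z <= 1 - 2 * tau, dl / 2 <= d z -> 1 <= s e i z,
    {for z, continuous (s e i)} & vpsh (fun w => - s e i w) z].
  have [dlp|dln] := ltP 0 dl; last by exists 0.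
  have [e1 e10 he1] := ln_large (8 * B + 1).
  have [e2 e20 he2] := ln_large (- 4 * (B + ln (dl / 4))).
  have [e0_0 e0_1] := andP e01.
  have V0 : 0 < V by apply: lt_le_trans V1.
  (* The bound e2 makes the quotient in s at least - tau where d >= dl / 2, since
     there d(z - e v_i) >= dl / 4. *)
  pose e := Num.min (Num.min e0 (dl / 2)) (Num.min (Num.min e1 e2) (dl / 4 / V)).
  have e_0 : 0 < e by rewrite !lt_min e0_0 e10 e20 !divr_gt0.
  have : e <= e by [].
  rewrite {2}/e !le_min => /andP[/andP[ee0 edl] /andP[/andP[ee1 ee2] eV]].
  have hL1 : 8 * B + 1 <= - ln e by apply: he1; rewrite e_0.
  have hL2 : - 4 * (B + ln (dl / 4)) <= - ln e by apply: he2; rewrite e_0.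
  move: eV; rewrite ler_pdivlMr // => eV.
  clearbody e; exists e => _; split; first by rewrite e_0.
  move=> i z Oz hz.
  have [dw0 /andP[b1 b2] b3 b4] := hB i z Oz hz e (introT andP (conj e_0 ee0)).
  have L0 : 0 < - ln e by lra.
  have NL0 : 0 < N%:R * - ln e by rewrite mulr_gt0.
  set X := ln (d (z - e%:C *: v i)) in b1 b2 b3 b4.
  have sE : s e i z = 1 + tau + (B + X) / (N%:R * - ln e) by [].
  have q8 : B / (N%:R * - ln e) <= tau / 2.
    rewrite ler_pdivrMr // mulrA [tau / 2]mulrC -[2^-1 * tau * _]mulrA tN; lra.
  split.
  - apply/andP; split.
      have : -1 <= (B + X) / (N%:R * - ln e) by rewrite ler_pdivlMr //; lra.
      by rewrite sE; lra.
    have : (B + X) / (N%:R * - ln e) <= 2 * (B / (N%:R * - ln e)).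
      by rewrite mulrA ler_wpM2r ?invr_ge0 ?(ltW NL0) //; lra.
    by rewrite sE; lra.
  - move=> dze; have bX := b3 dze.
    have : (B + X) / (N%:R * - ln e) <= (2 * B + ln e) / (N%:R * - ln e).
      by rewrite ler_wpM2r ?invr_ge0 ?(ltW NL0) //; lra.
    have -> : (2 * B + ln e) / (N%:R * - ln e) = 2 * (B / (N%:R * - ln e)) - 4 * tau.
      move: (ln e) (lt_eqF (etrans (esym (oppr_gt0 (ln e))) L0)) => Y Y0.
      by rewrite /tau; field; rewrite Y0 (gt_eqF NR0).
    by rewrite sE; lra.
  - move=> dldz; have dl20 : 0 < dl / 2 by rewrite divr_gt0.
    have bX : ln (dl / 2 / 2) <= X by apply: b4 => //; lra.
    have d4 : dl / 2 / 2 = dl / 4 by field.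
    rewrite d4 in bX.
    have : - tau <= (B + X) / (N%:R * - ln e).
      rewrite ler_pdivlMr // mulrA mulNr tN; lra.
    by rewrite sE; lra.
  - apply: contD_at; first exact: cst_continuous.
    apply: contM_at; last exact: cst_continuous.
    apply: contD_at; first exact: cst_continuous.
    apply: cont_comp_at.
      have : continuous (fun z : T => d (z - e%:C *: v i)).
        apply: lip_cont => x y; rewrite lerBlDl.
        have := bdist_lip bO (y - e%:C *: v i) (x - e%:C *: v i).
        by rewrite opprB addrA subrK nrB.
      by apply.
    exact: continuous_ln.
  - have Ow : Omega (z - e%:C *: v i) by apply/(bdist_gt0 oO bO).
    have sN0 : 0 < (N%:R * - ln e)^-1 by rewrite invr_gt0.
    have h := vpsh_quadratic sN0 (@psh_quadratic_cst _ _ (- (1 + tau + B / (N%:R * - ln e))))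
      (vpsh_shift (oka Ow)).
    apply: (vpsh_support (e := 1) ltr01 h).
      by rewrite /s; lra.
    by move=> w _; rewrite /s mulrDl; lra.
have [nxt hnxt] := boolp.choice step.
pose dl k := iter k nxt dl0.
have dlp k : 0 < dl k.
  by elim: k => // k IH; have [/andP[]] := hnxt _ IH.
exists (fun k => s (dl k.+1)), dl, tau, (1 - 2 * tau); split => //.
- by rewrite tau0; lra.
- by apply/andP; split; lra.
- by move=> k; have := hnxt _ (dlp k).
Qed.

End LocalBarriers.

(** * Geometric means and weights *)

Section Glue.
Variables (R : realType) (m : nat).
Local Notation C := R[i].
Local Notation T := 'rV[C]_m.+1.

Lemma vpsh_cst (c : R) (z : T) : vpsh (fun=> c) z.
Proof.
move=> b al be eps r eps0 r0 ht; pose x : C := r%:C.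
have hx (w : C) : nr w = 1 -> nr (x * w) = r.
  by move=> w1; rewrite nrCM w1 mulr1 nr_real gtr0_norm.
have := rotation_sum al be x.
have h (w : C) : nr w = 1 -> 0 <= complex.Re (al * (x * w) + be * (x * w) ^+ 2) - eps * r ^+ 2.
  by move=> w1; have := ht (x * w); rewrite hx // => /(_ (lexx r)); rewrite -addrA lerDl.
have h1 := h 1 (@nrC1 R); have h2 := h 'i (@nrC_i R).
have h3 : _ := h (- 1) _; rewrite nrN in h3; have {}h3 := h3 (@nrC1 R).
have h4 : _ := h (- 'i) _; rewrite nrN in h4; have {}h4 := h4 (@nrC_i R).
have : 0 < eps * r ^+ 2 by rewrite mulr_gt0 // exprn_gt0.
move: h1 h2 h3 h4.
move: (complex.Re _) (complex.Re _) (complex.Re _) (complex.Re _) (eps * r ^+ 2).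
by move=> r1 r2 r3 r4 E; lra.
Qed.

(** The tangent line of exp at the weighted mean of ln (x/x0) and ln (y/y0)
    lies below exp. *)
Lemma weighted_amgm (eta x y x0 y0 : R) : 0 < eta < 1 -> 0 < x -> 0 < y -> 0 < x0 -> 0 < y0 ->
  expR (eta * ln x + (1 - eta) * ln y) <=
  expR (eta * ln x0 + (1 - eta) * ln y0) * (eta * (x / x0) + (1 - eta) * (y / y0)).
Proof.
move=> /andP[e0 e1] x_0 y_0 x00 y00.
pose A := ln x - ln x0; pose B := ln y - ln y0; pose mm := eta * A + (1 - eta) * B.
have -> : eta * ln x + (1 - eta) * ln y = (eta * ln x0 + (1 - eta) * ln y0) + mm.
  by rewrite /mm /A /B; ring.
rewrite expRD ler_wpM2l ?expR_ge0 //.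
have tang (t : R) : expR mm * (1 + (t - mm)) <= expR t.
  have -> : expR t = expR mm * expR (t - mm) by rewrite -expRD; congr expR; ring.
  by rewrite ler_wpM2l ?expR_ge0 // expR_ge1Dx.
have hA : x / x0 = expR A by rewrite /A expRD expRN !lnK.
have hB : y / y0 = expR B by rewrite /B expRD expRN !lnK.
rewrite hA hB.
have h1 := tang A; have h2 := tang B.
have h3 : eta * (expR mm * (1 + (A - mm))) <= eta * expR A by rewrite ler_wpM2l // ltW.
have h4 : (1 - eta) * (expR mm * (1 + (B - mm))) <= (1 - eta) * expR B.
  by rewrite ler_wpM2l // subr_ge0 ltW.
apply: le_trans (lerD h3 h4).
rewrite le_eqVlt; apply/orP; left; apply/eqP; rewrite /mm; ring.
Qed.

(** By [weighted_amgm] the weighted geometric mean of s and q is at most a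
    positive combination of s and q, with equality at z. The negative of
    this combination is vpsh, and it supports the function from below. *)
Lemma geometric_mean_vpsh (s q : T -> R) (z : T) (K eta e : R) : 0 < eta < 1 -> 0 < e ->
  (forall w, nr (w - z) < e -> 0 < s w /\ 0 < q w) ->
  vpsh (fun w => - s w) z -> psh_quadratic (fun w => - q w) ->
  vpsh (fun w => - expR (K + (eta * ln (s w) + (1 - eta) * ln (q w)))) z.
Proof.
move=> he e0 hpos vs pq; have /andP[eta0 eta1] := he.
have [s0 q0] : 0 < s z /\ 0 < q z by apply: hpos; rewrite subrr nr0.
pose X := expR (K + (eta * ln (s z) + (1 - eta) * ln (q z))).
have X0 : 0 < X by exact: expR_gt0.
have p1 : 0 < X * eta / s z by rewrite divr_gt0 // mulr_gt0.
have pq2 : psh_quadratic (fun w => X * (1 - eta) / q z * - q w).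
  move=> y b; have [ga [H [H0 hH]]] := pq y b.
  have k0 : 0 <= X * (1 - eta) / q z by rewrite divr_ge0 ?mulr_ge0 ?subr_ge0 ?(ltW X0) // ltW.
  exists ((X * (1 - eta) / q z)%:C * ga), (X * (1 - eta) / q z * H).
  split; first by rewrite mulr_ge0.
  by move=> x; rewrite hH -[_%:C * ga * x]mulrA ReZ; ring.
apply: (vpsh_support e0 (vpsh_quadratic p1 pq2 vs)).
  rewrite -/X; field; by rewrite (gt_eqF s0) (gt_eqF q0).
move=> w /hpos[sw qw]; rewrite lerNr.
have := weighted_amgm he sw qw s0 q0; rewrite expRD => h.
apply: (le_trans (ler_wpM2l (expR_ge0 K) h)); rewrite le_eqVlt; apply/orP; left; apply/eqP.
have -> : X = expR K * expR (eta * ln (s z) + (1 - eta) * ln (q z)) by rewrite /X expRD.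
by field; rewrite (gt_eqF s0) (gt_eqF q0).
Qed.

(** The weights are q_i = Mq + |z - a_i|^2 / rho_i^2 - A |z|^2. The term
    A |z|^2 makes - q_i psh and is common to all charts, so that q_i is smaller
    than q_j by a definite amount near a_i and near the rim of the j-th ball. *)
Lemma chart_weights (Omega : set T) (M : R) (I : finType) (a : I -> T) (rho : I -> R) :
  (forall z, Omega z -> nr z <= M) -> (forall i, 0 < rho i) ->
  exists (q : I -> T -> R) (Q : R), [/\ 1 <= Q,
    forall i z, Omega z -> sqnorm (z - a i) < rho i ^+ 2 -> 1 <= q i z <= Q,
    forall i, continuous (q i), forall i, psh_quadratic (fun w => - q i w) &
    forall i j z, sqnorm (z - a i) < (rho i / 2) ^+ 2 ->
      (3 / 4 * rho j) ^+ 2 < sqnorm (z - a j) -> q i z + 5 / 16 <= q j z].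
Proof.
move=> bO r0; pose A := \sum_i (rho i) ^- 2.
have ri0 i : 0 < rho i ^+ 2 by rewrite exprn_gt0.
have Ai i : rho i ^- 2 <= A.
  rewrite /A (bigD1 i) //= lerDl sumr_ge0 // => j _.
  by rewrite invr_ge0 ltW.
have A0 : 0 <= A by rewrite sumr_ge0 // => i _; rewrite invr_ge0 ltW.
pose Mq := 1 + A * (m.+1%:R * M ^+ 2).
have Mq1 : 1 <= Mq by rewrite /Mq lerDl mulr_ge0 // mulr_ge0 ?sqr_ge0.
exists (fun i z => Mq + (rho i ^- 2 * sqnorm (z - a i) - A * sqnorm (z - 0))), (Mq + 1).
split.
- by lra.
- move=> i z Oz hz.
  have h1 : rho i ^- 2 * sqnorm (z - a i) <= 1 by rewrite ler_pdivrMl // mulr1 ltW.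
  have h2 : 0 <= rho i ^- 2 * sqnorm (z - a i).
    by rewrite mulr_ge0 ?sqnorm_ge0 // invr_ge0 ltW.
  have h3 : 0 <= A * sqnorm (z - 0) by rewrite mulr_ge0 // sqnorm_ge0.
  have h4 : A * sqnorm (z - 0) <= A * (m.+1%:R * M ^+ 2).
    rewrite ler_wpM2l // subr0 (le_trans (sqnorm_le _)) // ler_wpM2l //.
    by rewrite ler_pXn2r ?nnegrE ?nr_ge0 ?bO // (le_trans (nr_ge0 z)) // bO.
  by move: h4; rewrite /Mq => h4; apply/andP; split; lra.
- move=> i z; apply: contD_at; first exact: cst_continuous.
  by apply: contB_at; apply: contM_at; try exact: cst_continuous; exact: sqnorm_cont.
- move=> i z b.
  have [g1 h1] := sqnorm_line (z - a i) b; have [g2 h2] := sqnorm_line (z - 0) b.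
  exists (A%:C * g2 - (rho i ^- 2)%:C * g1), ((A - rho i ^- 2) * sqnorm b).
  split; first by rewrite mulr_ge0 ?sqnorm_ge0 // subr_ge0.
  move=> x; rewrite ![z + x *: b - _]addrAC h1 h2 mulrBl ReD ReN -!mulrA.
  by rewrite !ReZ; ring.
- move=> i j z hi hj.
  have h1 : rho i ^- 2 * sqnorm (z - a i) <= 4^-1.
    rewrite ler_pdivrMl //; move: hi; rewrite exprMn exprVn; lra.
  have h2 : 9 / 16 <= rho j ^- 2 * sqnorm (z - a j).
    rewrite ler_pdivlMl //; move: hj; rewrite exprMn; lra.
  lra.
Qed.

End Glue.

(** * The exhaustion function *)

Section Exhaustion.
Variables (R : realType) (m : nat).
Local Notation C := R[i].
Local Notation T := 'rV[C]_m.+1.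
Variables (Omega : set T) (M : R).
Hypothesis oO : open Omega.
Hypothesis bO : forall z, Omega z -> nr z <= M.
Local Notation d := (bdist Omega).
Variables (I : finType) (a : I -> T) (rho : I -> R).
Hypothesis rho0 : forall i, 0 < rho i.
Variables (s : nat -> I -> T -> R) (dl : nat -> R) (tau gam : R).
Hypotheses (tau01 : 0 < tau <= 1) (gam01 : 0 < gam < 1).
Hypothesis dl_step : forall k, 0 < dl k.+1 <= dl k / 2.
Hypothesis halves_cover : forall z, Omega z -> d z < dl 0%N ->
  exists i, sqnorm (z - a i) < (rho i / 2) ^+ 2.
Hypothesis s_spec : forall k i z, Omega z -> sqnorm (z - a i) < rho i ^+ 2 ->
  [/\ tau <= s k i z <= 2, d z <= dl k.+1 -> s k i z <= gam, dl k / 2 <= d z -> 1 <= s k i z,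
   {for z, continuous (s k i)} & vpsh (fun w => - s k i w) z].
Variables (q : I -> T -> R) (Q eta kap : R).
Hypothesis Q1 : 1 <= Q.
Hypothesis qQ : forall i z, Omega z -> sqnorm (z - a i) < rho i ^+ 2 -> 1 <= q i z <= Q.
Hypothesis cq : forall i, continuous (q i).
Hypothesis pq : forall i, psh_quadratic (fun w => - q i w).
Hypothesis q_gap : forall i j z, sqnorm (z - a i) < (rho i / 2) ^+ 2 ->
  (3 / 4 * rho j) ^+ 2 < sqnorm (z - a j) -> q i z + 5 / 16 <= q j z.
Hypotheses (eta01 : 0 < eta < 1) (kap01 : gam < kap < 1).
Hypothesis eta_small : eta * (ln 2 - ln tau) < (1 - eta) * (5 / 16 / Q).

(** The k-th barrier of the i-th chart takes part only in the i-th ball and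
    close to the boundary; it is beaten before it ceases to be active. *)
Definition active k i z := [/\ Omega z, sqnorm (z - a i) < rho i ^+ 2 & d z < dl k].

(** The logarithm of (kap^k s_k,i)^eta * q_i^(1 - eta). *)
Definition ell k i z := k%:R * (eta * ln kap) + (eta * ln (s k i z) + (1 - eta) * ln (q i z)).

Definition piece k i z := - expR (ell k i z).

Let eta0 : 0 < eta. Proof. by case/andP: eta01. Qed.
Let eta1 : 0 < 1 - eta. Proof. by case/andP: eta01 => _; rewrite subr_gt0. Qed.
Let gam0 : 0 < gam. Proof. by case/andP: gam01. Qed.
Let kap0 : 0 < kap. Proof. by case/andP: kap01 => h _; apply: lt_trans h. Qed.
Let lnkap : ln kap < 0. Proof. by apply: ln_lt0; rewrite kap0; case/andP: kap01. Qed.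

Lemma dl_gt0 k : 0 < dl k.
Proof.
case: k => [|k]; last by case/andP: (dl_step k).
by have /andP[h1 h2] := dl_step 0; lra.
Qed.

Lemma dl_decay k : dl k * k.+1%:R <= dl 0%N.
Proof.
elim: k => [|k IH]; first by rewrite mulr1.
have /andP[h1 h2] := dl_step k; apply: le_trans IH.
have k0 : (0 : R) <= k%:R by [].
rewrite -!natr1; nra.
Qed.

Lemma dlS k : dl k.+1 < dl k.
Proof. by have /andP[h1 h2] := dl_step k; have := dl_gt0 k; lra. Qed.

Lemma dl_le0 k : dl k <= dl 0%N.
Proof. by elim: k => // k; apply: le_trans; apply/ltW/dlS. Qed.

Lemma active_pos k i z : active k i z -> 0 < s k i z /\ 0 < q i z.
Proof.
move=> [Oz hz _]; have [/andP[h _] _ _ _ _] := s_spec k Oz hz.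
have /andP[h' _] := qQ Oz hz; case/andP: tau01 => t0 _; lra.
Qed.

Lemma active_open k i z : active k i z ->
  exists2 e, 0 < e & forall w, nr (w - z) < e -> active k i w.
Proof.
move=> [Oz hz dz].
have /open_nrP/(_ _ Oz)[e1 e10 he1] := oO.
have c1 : 0 < rho i ^+ 2 - sqnorm (z - a i) by rewrite subr_gt0.
have /cont_nrP/(_ _ c1)[e2 e20 he2] := @sqnorm_cont _ _ (a i) z.
have c2 : 0 < dl k - d z by rewrite subr_gt0.
have /cont_nrP/(_ _ c2)[e3 e30 he3] := @bdist_cont _ _ _ _ bO z.
exists (Num.min e1 (Num.min e2 e3)); first by rewrite !lt_min e10 e20.
move=> w; rewrite !lt_min => /andP[w1 /andP[w2 w3]]; split; first exact: he1.
  by have := he2 w w2; rewrite ltr_norml => /andP[_]; lra.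
by have := he3 w w3; rewrite ltr_norml => /andP[_]; lra.
Qed.

Lemma piece_vpsh k i z : active k i z -> vpsh (piece k i) z.
Proof.
move=> az; have [e e0 he] := active_open az.
have [Oz hz _] := az; have [_ _ _ _ vs] := s_spec k Oz hz.
apply: (@geometric_mean_vpsh _ _ _ _ _ _ _ e) => //.
by move=> w /he; exact: active_pos.
Qed.

Lemma piece_cont k i z : active k i z -> {for z, continuous (piece k i)}.
Proof.
move=> az; have [s0 q0] := active_pos az.
have [Oz hz _] := az; have [_ _ _ cs _] := s_spec k Oz hz.
apply: (@cont_comp_at _ _ (ell k i) (fun x => - expR x)); last first.
  by apply: continuousN; exact: continuous_expR.
apply: contD_at; first exact: cst_continuous.
apply: contD_at; apply: contM_at; try exact: cst_continuous.
  by apply: cont_comp_at => //; exact: continuous_ln.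
by apply: cont_comp_at; [exact: cq|exact: continuous_ln].
Qed.

Lemma ell_le k i z : active k i z ->
  ell k i z <= k%:R * (eta * ln kap) + (eta * ln 2 + (1 - eta) * ln Q).
Proof.
move=> az; have [s0 q0] := active_pos az; have [Oz hz _] := az.
have [/andP[_ s2] _ _ _ _] := s_spec k Oz hz; have /andP[_ qQ'] := qQ Oz hz.
rewrite /ell lerD2l lerD // ler_pM2l // ler_ln ?posrE //.
by apply: lt_le_trans Q1.
Qed.

(** In the shell dl (k+1) / 2 <= d < dl (k+1) the k-th barrier has already
    dropped to gam while the next one is still at least 1, and
    kap^k gam < kap^(k+1). *)
Lemma piece_beaten_shell k i z : active k.+1 i z -> dl k.+1 / 2 <= d z ->
  active k i z /\ piece k.+1 i z < piece k i z.
Proof.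
move=> az hd; have [Oz hz dz] := az.
have az' : active k i z by split => //; apply: lt_trans dz (dlS k).
split => //; rewrite /piece ltrN2 ltr_expR /ell.
have [_ h1 _ _ _] := s_spec k Oz hz; have [_ _ h2 _ _] := s_spec k.+1 Oz hz.
have sg : ln (s k i z) <= ln gam.
  by rewrite ler_ln ?posrE ?(active_pos az').1 // h1 // ltW.
have s1 : 0 <= ln (s k.+1 i z) by rewrite ln_ge0 // h2.
have gk : ln gam < ln kap by rewrite ltr_ln ?posrE //; case/andP: kap01.
rewrite -natr1 mulrDl mul1r.
have h3 : eta * ln (s k i z) < eta * ln kap by rewrite ltr_pM2l //; apply: le_lt_trans gk.
have h4 : 0 <= eta * ln (s k.+1 i z) by rewrite mulr_ge0 // ltW.
lra.
Qed.

Lemma piece_beaten_first i z : active 0 i z -> dl 0%N / 2 <= d z -> piece 0 i z <= - 1.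
Proof.
move=> az hd; have [Oz hz dz] := az.
have [_ _ h2 _ _] := s_spec 0 Oz hz; have /andP[q1 _] := qQ Oz hz.
rewrite /piece lerN2 -[leLHS]expR0 ler_expR /ell mul0r add0r.
by rewrite addr_ge0 // mulr_ge0 ?ln_ge0 ?h2 ?(ltW eta0) ?(ltW eta1).
Qed.

(** At the rim of the j-th ball, take the chart i in whose half ball z lies.
    The barriers of the two charts have a ratio of at most 2 / tau, and the
    power eta is so small that the weights decide. *)
Lemma piece_beaten_rim k j z : active k j z -> (3 / 4 * rho j) ^+ 2 < sqnorm (z - a j) ->
  exists i, active k i z /\ piece k j z < piece k i z.
Proof.
move=> az hj; have [Oz hz dz] := az.
have [i hi] := halves_cover Oz (lt_le_trans dz (dl_le0 k)).
have ai : active k i z.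
  split => //; apply: (lt_trans hi).
  by rewrite ltr_pXn2r ?nnegrE ?divr_ge0 ?(ltW (rho0 i)) //; have := rho0 i; lra.
exists i; split => //; rewrite /piece ltrN2 ltr_expR /ell ltrD2l.
have [Oz' hz' _] := ai.
have [/andP[_ s2] _ _ _ _] := s_spec k Oz hz'; have [/andP[st _] _ _ _ _] := s_spec k Oz hz.
have /andP[qi1 qiQ] := qQ Oz hz'; have /andP[qj1 qjQ] := qQ Oz hz.
have gap := q_gap hi hj.
have Q0 : 0 < Q by apply: lt_le_trans Q1.
have qi0 : 0 < q i z by apply: lt_le_trans qi1.
have qj0 : 0 < q j z by apply: lt_le_trans qj1.
have h1 : ln (s k i z) <= ln 2 by rewrite ler_ln ?posrE ?(active_pos ai).1.
have t0 : 0 < tau by case/andP: tau01.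
have h2 : ln tau <= ln (s k j z) by rewrite ler_ln ?posrE ?(active_pos az).1.
have h3 : ln (q i z) <= ln (q j z) - 5 / 16 / Q.
  pose D := 5 / 16 / Q; have DQ : D * Q = 5 / 16 by rewrite /D divfK // gt_eqF.
  have D0 : 0 < D by rewrite divr_gt0.
  have h : q i z <= q j z * expR (- D).
    have h' : q j z * (1 + - D) <= q j z * expR (- D) by rewrite ler_wpM2l ?expR_ge1Dx // ltW.
    have h'' : D * q j z <= D * Q by rewrite ler_wpM2l // ltW.
    lra.
  have : ln (q i z) <= ln (q j z * expR (- D)) by rewrite ler_ln ?posrE // mulr_gt0 // expR_gt0.
  by rewrite lnM ?posrE ?expR_gt0 // expRK.
have h4 : eta * ln (s k i z) <= eta * ln 2 by rewrite ler_pM2l.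
have h5 : eta * ln tau <= eta * ln (s k j z) by rewrite ler_pM2l.
have h6 : (1 - eta) * ln (q i z) <= (1 - eta) * (ln (q j z) - 5 / 16 / Q) by rewrite ler_pM2l.
move: eta_small h6; rewrite !mulrBr => h7 h6.
lra.
Qed.

(** A bound for the indices k that are active at z. *)
Definition scales z := (Num.truncn (dl 0%N / d z)).+1.

Lemma scalesP z k : Omega z -> d z < dl k -> (k < scales z)%N.
Proof.
move=> Oz hk; rewrite ltnNge; apply/negP => hk'.
have d0 : 0 < d z by apply/(bdist_gt0 oO bO).
have : dl 0%N / d z < k%:R.
  by rewrite -truncn_lt_nat // divr_ge0 // ltW // dl_gt0.
rewrite ltr_pdivrMr // => h.
have := dl_decay k; rewrite -natr1 => h2.
have k0 : (0 : R) <= k%:R by [].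
have := dl_gt0 k; nra.
Qed.

(** The constant - 1/2 is the value far from the boundary. It exceeds the
    pieces with k = 0 where these cease to be active. *)
Definition exhaustion z := \big[Num.max/ - 2^-1]_(p : 'I_(scales z) * I | `[< active p.1 p.2 z >])
  piece p.1 p.2 z.

Lemma exhaustion_ge z : - 2^-1 <= exhaustion z.
Proof. exact: bigmax_ge_id. Qed.

Lemma exhaustion_ge_piece k i z : active k i z -> piece k i z <= exhaustion z.
Proof.
move=> az; have [Oz _ dz] := az; have hk := scalesP Oz dz.
apply: (@le_bigmax_cond _ _ _ _ (Ordinal hk, i)); exact/asboolP.
Qed.

Lemma exhaustion_attained z : exhaustion z = - 2^-1 \/
  exists k i, active k i z /\ exhaustion z = piece k i z.
Proof.
rewrite /exhaustion; elim/big_ind: _ => [|x y hx hy|[k i] /= /asboolP az]; first by left.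
  by rewrite /Num.max; case: ifP.
by right; exists k, i.
Qed.

(** Lower semicontinuity holds because active pieces stay active nearby. For
    upper semicontinuity, a piece that attains the maximum at w near z is
    beaten neither in the shell nor at the rim, hence is active at z as well;
    near z only finitely many pieces compete. *)
Lemma exhaustion_cont z : Omega z -> {for z, continuous exhaustion}.
Proof.
move=> Oz; apply/cont_nrP => e e0.
have d0 : 0 < d z by apply/(bdist_gt0 oO bO).
have lower : exists2 r, 0 < r & forall w, nr (w - z) < r -> exhaustion z - e < exhaustion w.
  have [->|[k [i [az ->]]]] := exhaustion_attained z.
    exists 1 => // w _; apply: lt_le_trans (exhaustion_ge w); lra.
  have [r2 r20 hr2] := active_open az.
  have /cont_nrP/(_ _ e0)[r3 r30 hr3] := piece_cont az.
  exists (Num.min r2 r3); first by rewrite lt_min r20.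
  move=> w; rewrite lt_min => /andP[w2 w3]; apply: lt_le_trans (exhaustion_ge_piece (hr2 w w2)).
  by have := hr3 w w3; rewrite ltr_norml => /andP[h _]; lra.
have [n hn] : exists n, forall k, (n <= k)%N -> dl k <= d z / 2.
  exists (Num.truncn (dl 0%N / (d z / 2))).+1 => k hk.
  have d20 : 0 < d z / 2 by rewrite divr_gt0.
  have : dl 0%N / (d z / 2) < k%:R.
    by rewrite -truncn_lt_nat // divr_ge0 ?(ltW d20) // ltW // dl_gt0.
  rewrite ltr_pdivrMr // => h; have := dl_decay k; rewrite -natr1 => h2.
  have k0 : (0 : R) <= k%:R by [].
  have := dl_gt0 k; nra.
have near_piece (p : 'I_n * I) : \forall w \near z, active p.1 p.2 w ->
    sqnorm (w - a p.2) <= (3 / 4 * rho p.2) ^+ 2 -> d w < dl p.1 / 2 ->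
    piece p.1 p.2 w < exhaustion z + e.
  case: p => k i /=; have [az|naz] := pselect (active k i z).
    have /cont_nrP/(_ _ e0)[r3 r30 hr3] := piece_cont az.
    apply/nbhs_nrP; exists r3 => // w /hr3; rewrite ltr_norml => /andP[_ h] _ _ _.
    by have := exhaustion_ge_piece az; lra.
  have [hz|hz] := ltP (sqnorm (z - a i)) (rho i ^+ 2); last first.
    have c1 : 0 < sqnorm (z - a i) - (3 / 4 * rho i) ^+ 2.
      rewrite subr_gt0; apply: lt_le_trans hz; rewrite exprMn.
      have : 0 < rho i ^+ 2 by rewrite exprn_gt0.
      lra.
    have /cont_nrP/(_ _ c1)[r3 r30 hr3] := @sqnorm_cont _ _ (a i) z.
    apply/nbhs_nrP; exists r3 => // w /hr3; rewrite ltr_norml => /andP[h _] _ h2 _.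
    by exfalso; lra.
  have hd : dl k <= d z by rewrite leNgt; apply/negP => h; apply: naz.
  have c2 : 0 < d z - dl k / 2 by have := dl_gt0 k; lra.
  have /cont_nrP/(_ _ c2)[r3 r30 hr3] := @bdist_cont _ _ _ _ bO z.
  apply/nbhs_nrP; exists r3 => // w /hr3; rewrite ltr_norml => /andP[h _] _ _ h2.
  by exfalso; lra.
have : \forall w \near z, forall p : 'I_n * I, active p.1 p.2 w ->
    sqnorm (w - a p.2) <= (3 / 4 * rho p.2) ^+ 2 -> d w < dl p.1 / 2 ->
    piece p.1 p.2 w < exhaustion z + e.
  exact: (filter_forall (nbhs_filter z) near_piece).
move=> /nbhs_nrP[r4 r40 hr4].
have d20 : 0 < d z / 2 by rewrite divr_gt0.
have /cont_nrP/(_ _ d20)[r5 r50 hr5] := @bdist_cont _ _ _ _ bO z.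
have [r2 r20 hr2] := lower.
exists (Num.min r2 (Num.min r4 r5)); first by rewrite !lt_min r20 r40.
move=> w; rewrite !lt_min => /andP[w2 /andP[w4 w5]].
rewrite ltr_norml; apply/andP; split; first by have := hr2 w w2; lra.
rewrite ltrBlDl.
have [->|[k [i [aw hw]]]] := exhaustion_attained w; first by have := exhaustion_ge z; lra.
have kn : (k < n)%N.
  rewrite ltnNge; apply/negP => /hn hk; have [_ _ dw] := aw.
  by have := hr5 w w5; rewrite ltr_norml => /andP[h _]; lra.
have rim : sqnorm (w - a i) <= (3 / 4 * rho i) ^+ 2.
  rewrite leNgt; apply/negP => /(piece_beaten_rim aw)[j [aj hj]].
  by have := exhaustion_ge_piece aj; rewrite hw leNgt hj.
have shell : d w < dl k / 2.
  rewrite ltNge; apply/negP => hd; case: k aw hw kn hd => [|k] aw hw _ hd.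
    by have := piece_beaten_first aw hd; have := exhaustion_ge w; rewrite hw; lra.
  have [ak hk] := piece_beaten_shell aw hd.
  by have := exhaustion_ge_piece ak; rewrite hw leNgt hk.
by rewrite hw; apply: (hr4 w w4 (Ordinal kn, i)).
Qed.

Lemma exhaustion_vpsh z : Omega z -> vpsh exhaustion z.
Proof.
move=> Oz; have [h|[k [i [az h]]]] := exhaustion_attained z.
  apply: (vpsh_support ltr01 (@vpsh_cst _ _ (- 2^-1) z)) => // w _; exact: exhaustion_ge.
have [e e0 he] := active_open az.
apply: (vpsh_support e0 (piece_vpsh az)) => // w /he; exact: exhaustion_ge_piece.
Qed.

(** Where d < dl k, a chart whose half ball contains z has an active k-th
    piece, so the exhaustion is at least - O(kap^(k eta)). *)
Lemma hyperconvex_exhaustion : hyperconvex Omega.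
Proof.
exists exhaustion; split.
- move=> z _; have [->|[k [i [_ ->]]]] := exhaustion_attained z.
    by rewrite oppr_lt0 invr_gt0.
  by rewrite /piece oppr_lt0 expR_gt0.
- by apply: continuous_in_subspaceT => z /set_mem; exact: exhaustion_cont.
- apply: vpsh_psh => //; [exact: exhaustion_cont|exact: exhaustion_vpsh].
move=> c c0.
pose B := eta * ln 2 + (1 - eta) * ln Q.
pose L := - (eta * ln kap).
have L0 : 0 < L by rewrite /L oppr_gt0 pmulr_rlt0.
pose k := (Num.truncn (`|B - ln c| / L)).+1.
have hk : `|B - ln c| / L < k%:R by rewrite -truncn_lt_nat // divr_ge0 // ltW.
rewrite ltr_pdivrMr // in hk.
have far z : Omega z -> exhaustion z < - c -> dl k <= d z.
  move=> Oz hz; rewrite leNgt; apply/negP => dz.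
  have [i hi] := halves_cover Oz (lt_le_trans dz (dl_le0 k)).
  have ai : active k i z.
    split => //; apply: (lt_trans hi).
    by rewrite ltr_pXn2r ?nnegrE ?divr_ge0 ?(ltW (rho0 i)) //; have := rho0 i; lra.
  have := exhaustion_ge_piece ai; rewrite leNgt => /negP; apply; apply: (lt_le_trans hz).
  rewrite /piece lerN2 -[leRHS]lnK ?posrE // ler_expR; apply: (le_trans (ell_le ai)).
  rewrite -/B; have := ler_norm (B - ln c).
  have -> : eta * ln kap = - L by rewrite opprK.
  by rewrite mulrN; lra.
have cl : closure [set z | Omega z /\ exhaustion z < - c] `<=` [set z | dl k <= d z].
  have /continuous_closedP/(_ _ (@closed_ge R (dl k))) := @bdist_cont _ _ _ _ bO.
  move=> /closure_id hcl; rewrite [X in _ `<=` X]hcl.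
  by apply: closureS => z /= [Oz hz]; exact: far.
split.
  apply: subclosed_compact cl; first exact: closed_closure.
  exact: (bdist_ge_compact oO bO (dl_gt0 k)).
by move=> z /cl /= hz; apply/(bdist_gt0 oO bO); apply: lt_le_trans hz; exact: dl_gt0.
Qed.

End Exhaustion.

(** * The theorem *)

Lemma bounded_nr (R : realType) (V : normedModType R[i]) (A : set V) :
  bounded_set A -> exists M : R, forall z, A z -> nr z <= M.
Proof.
move=> [M [Mr hM]]; exists (complex.Re (M + 1)) => z Az.
have MM : M < M + 1 by rewrite ltrDl ltr01.
have := hM _ MM z Az; rewrite /= nrE.
by rewrite lecE => /andP[_].
Qed.

Lemma continuous_at_open (R : realType) (V : normedModType R[i]) (A : set V) (f : V -> R) :
  open A -> {within A, continuous f} -> forall z, A z -> {for z, continuous f}.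
Proof.
move=> oA; rewrite continuous_open_subspace // => h z Az.
by apply: h; rewrite inE.
Qed.

Lemma hyperconvex_of_charts (R : realType) (m : nat) (Omega : set 'rV[R[i]]_m.+1) (M : R) :
  open Omega -> (forall z, Omega z -> nr z <= M) -> holder_boundary Omega ->
  (forall z, Omega z -> vpsh (fun w => - ln (bdist Omega w)) z) -> hyperconvex Omega.
Proof.
move=> oO bO hO oka.
have [I [a [v [rho [N [c [e0 [dl0 [[N0 c0 e01 dl00 rho0] [chart cov]]]]]]]]]] :=
  finite_charts oO bO hO.
have [V V1 hV] : exists2 V : R, 1 <= V & forall i, nr (v i) <= V.
  exists (1 + \sum_i nr (v i)); first by rewrite lerDl sumr_ge0 // => j _; exact: nr_ge0.
  move=> i; rewrite (bigD1 i) //= addrCA lerDl addr_ge0 // sumr_ge0 // => j _.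
  exact: nr_ge0.
have [s [dl [tau [gam [tau01 gam01 dlE hs]]]]] :=
  local_barriers oO bO oka N0 c0 e01 chart V1 hV dl00.
have [q [Q [Q1 qQ cq pq gap]]] := chart_weights a bO rho0.
have /andP[g0 g1] := gam01; have /andP[t0 t1] := tau01.
pose D : R := 5 / 16 / Q; pose lt := ln 2 - ln tau.
have D0 : 0 < D by rewrite !divr_gt0 // (lt_le_trans _ Q1).
have lt0 : 0 < lt.
  have h2 : 0 < ln 2 :> R by apply: ln_gt0; lra.
  by have := ln_le0 t1; rewrite /lt; lra.
(* This eta solves eta (lt + D) = D / 2 < D. *)
pose eta := D / (2 * (lt + D)).
have S0 : 0 < 2 * (lt + D) by lra.
have etaE : eta * (2 * (lt + D)) = D by rewrite /eta divfK // gt_eqF.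
have eta0 : 0 < eta by rewrite divr_gt0.
have eta1 : eta < 1 by rewrite /eta ltr_pdivrMr //; lra.
apply: (@hyperconvex_exhaustion R m Omega M oO bO I a rho rho0 s dl tau gam tau01 gam01 _ _ _
  q Q eta ((gam + 1) / 2)) => //.
- by move=> k; have [] := hs k.
- by rewrite dlE.
- by move=> k; have [] := hs k.
- by rewrite eta0.
- by apply/andP; split; lra.
- rewrite -/D -/lt; move: etaE; rewrite mulrCA mulrDr mulrBl mul1r; lra.
Qed.

Theorem theorem1p1 (R : realType) (m : nat) (Omega : set 'rV[R[i]]_m.+1)
    (Omega_domain : domain Omega) (Omega_bounded : bounded_set Omega)
    (Omega_pseudoconvex : pseudoconvex Omega)
    (Omega_holder : holder_boundary Omega) :
  hyperconvex Omega.
Proof.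
have [oO _ _] := Omega_domain.
have [M bO] := bounded_nr Omega_bounded.
have [phi [cphi pphi ephi]] := Omega_pseudoconvex.
have cphi' := continuous_at_open oO cphi.
have vphi := psh_vpsh oO cphi' pphi.
by apply: (hyperconvex_of_charts oO bO) => // z; exact: (oka_psh oO bO cphi' vphi ephi).
Qed.
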